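(* The unique minimiser of $I_1$ among probability measures in $\mathcal{P}(\mathbb{R}^2)$ is given by the semi-circle law $$\mu_1:=\frac{1}{\pi}\,\delta_0\otimes\sqrt{2-x_2^2}\;\mathcal{H}^1\llcorner(-\sqrt2,\sqrt2),$$ that is, the product of the Dirac mass at $x_1=0$ and the measure on the $x_2$-axis with density $\frac1\pi\sqrt{2-x_2^2}$ on $(-\sqrt2,\sqrt2)$.
   Context: $\mathcal{P}(\mathbb{R}^2)$ is the set of Borel probability measures on $\mathbb{R}^2$. The energy $I_1$ is $$I_1(\mu)=\frac12\iint_{\mathbb{R}^2\times\mathbb{R}^2}W_1(x-y)\,d\mu(x)\,d\mu(y)+\frac12\int_{\mathbb{R}^2}|x|^2\,d\mu(x),$$ understood as the single integral $\frac12\iint\big[W_1(x-y)+\frac12(|x|^2+|y|^2)\big]\,d\mu(x)\,d\mu(y)\in(-\infty,+\infty]$, where $$W_1(x_1,x_2)=-\frac12\log(x_1^2+x_2^2)+\frac{x_1^2}{x_1^2+x_2^2}\quad\text{for }(x_1,x_2)\ne(0,0),\qquad W_1(0):=+\infty.$$ $\mathcal{H}^1\llcorner A$ is the one-dimensional Hausdorff (Lebesgue) measure restricted to $A$. *)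

(* Defs.v *)
From HB Require Import structures.
From mathcomp Require Import all_boot all_order all_algebra.
From mathcomp Require Import all_classical all_reals all_analysis measurable_realfun.
From mathcomp Require Import ring lra.

Set Implicit Arguments.
Unset Strict Implicit.
Unset Printing Implicit Defensive.

Import Order.TTheory GRing.Theory Num.Theory.
Import numFieldNormedType.Exports.

Local Open Scope classical_set_scope.
Local Open Scope ring_scope.

Section energy.
Context {R : realType}.

(* The library norm on R * R is the sup norm, so the Euclidean norm is spelled
   out. *)
Definition sqnorm (x : R * R) : R := x.1 ^+ 2 + x.2 ^+ 2.

Definition W1 (x : R * R) : \bar R :=
  (if x == 0%R then +oo
   else (- 2^-1 * ln (x.1 ^+ 2 + x.2 ^+ 2)
         + x.1 ^+ 2 / (x.1 ^+ 2 + x.2 ^+ 2))%:E)%E.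

(* The product sigma-algebra carried by R * R is the Borel one, as R is second
   countable. *)
Definition I1 (mu : probability (R * R)%type R) : \bar R :=
  ((2^-1)%:E * \int[(mu \x mu)]_z
    (W1 (z.1 - z.2)%R + (2^-1 * (sqnorm z.1 + sqnorm z.2))%:E))%E.

Definition is_minimiser (J : probability (R * R)%type R -> \bar R)
    (mu : probability (R * R)%type R) : Prop :=
  forall nu : probability (R * R)%type R, (J mu <= J nu)%E.

End energy.

Section semicircle_law.
Context {R : realType}.
Local Notation leb := (@lebesgue_measure R).
Local Notation s2 := (Num.sqrt 2 : R).

Definition semicircle_pdf (x : R) : R := pi^-1 * Num.sqrt (2 - x ^+ 2).

Definition semicircle (A : set R) : \bar R :=
  (\int[leb]_(x in A `&` `](- Num.sqrt 2)%R, (Num.sqrt 2)%R[)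
     (semicircle_pdf x)%:E)%E.

Let pdf_ge0 x : 0 <= semicircle_pdf x.
Proof. by rewrite mulr_ge0 ?sqrtr_ge0// invr_ge0 pi_ge0. Qed.

Lemma continuous_semicircle_pdf : continuous semicircle_pdf.
Proof.
move=> x; apply: cvgM; first exact: cvg_cst.
apply: (@continuous_comp _ _ _ (fun x : R => 2 - x ^+ 2) Num.sqrt).
  by apply: cvgB; [exact: cvg_cst|exact: exprn_continuous].
exact: sqrt_continuous.
Qed.

Let mpdf (D : set R) : measurable_fun D (EFin \o semicircle_pdf).
Proof.
apply/measurable_EFinP/measurable_funTS; apply: continuous_measurable_fun.
exact: continuous_semicircle_pdf.
Qed.

Let semicircle0 : semicircle set0 = 0%E.
Proof. by rewrite /semicircle set0I integral_set0. Qed.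

Let semicircle_ge0 A : (0 <= semicircle A)%E.
Proof. by apply: integral_ge0 => x _; rewrite lee_fin. Qed.

Let semicircle_sigma_additive : semi_sigma_additive semicircle.
Proof.
move=> F mF tF mUF; rewrite /semicircle; apply: cvg_toP.
  apply: ereal_nondecreasing_is_cvgn => m n mn.
  by apply: lee_sum_nneg_natr => // k _ _; exact: semicircle_ge0.
rewrite setI_bigcupl ge0_integral_bigcup//=.
- move=> k; apply: measurableI; [exact: mF|exact: measurable_itv].
- exact: mpdf.
- by move=> x _; rewrite lee_fin.
- exact: trivIset_setIr.
Qed.

HB.instance Definition _ := isMeasure.Build _ _ _ semicircle
  semicircle0 semicircle_ge0 semicircle_sigma_additive.

Let is_derive_sub (t : R) : is_derive t 1 (fun t => s2 * sin t) (s2 * cos t).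
Proof. exact: is_deriveZ. Qed.

Let derive1_sub : derive1 (fun t : R => s2 * sin t) = (fun t => s2 * cos t).
Proof. by apply/funext => t; rewrite derive1E; apply: derive_val. Qed.

Let continuous_dsub : continuous (fun t : R => s2 * cos t).
Proof. by move=> t; apply: cvgM; [exact: cvg_cst|exact: continuous_cos]. Qed.

Let derivable_LR (f df : R -> R) (a b : R) :
  (forall t : R, is_derive t (1 : R) f (df t)) -> derivable_oo_LRcontinuous f a b.
Proof.
move=> fdf.
have cf t : {for t, continuous f}.
  by apply/differentiable_continuous/derivable1_diffP; case: (fdf t).
split.
- by move=> t _; case: (fdf t).
- exact/cvg_at_right_filter/cf.
- exact/cvg_at_left_filter/cf.
Qed.

Let is_derive_prim (t : R) :
  is_derive t 1 (fun t => pi^-1 * (t + sin t * cos t))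
    (pi^-1 * (2 * cos t ^+ 2)).
Proof.
have -> : 2 * cos t ^+ 2 = 1 + (sin t *: (- sin t) + cos t *: cos t) :> R.
  by rewrite /GRing.scale/= mulrN -!expr2 sin2cos2; ring.
apply: (@is_deriveZ _ _ _ (fun t : R => t + sin t * cos t)).
Qed.

Let semicircle_setT : semicircle [set: R] = 1%E.
Proof.
have pi20 : - (pi / 2) <= pi / 2 :> R by have := @pi_gt0 R; lra.
have pi0 : pi != 0 :> R by rewrite gt_eqF ?pi_gt0.
rewrite /semicircle setTI.
transitivity (\int[leb]_(x in `[(- s2)%R, s2]) (semicircle_pdf x)%:E)%E.
  by rewrite [RHS]integral_itv_bndoo//; exact: mpdf.
have sa : s2 * sin (- (pi / 2)) = - s2 by rewrite sinN sin_pihalf mulrN1.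
have sb : s2 * sin (pi / 2) = s2 by rewrite sin_pihalf mulr1.
rewrite -sa -[in X in `[_, X]%classic]sb.
rewrite (@integration_by_substitution_increasing _ (fun t => s2 * sin t))//.
- rewrite derive1_sub.
  transitivity (\int[leb]_(t in `[(- (pi / 2))%R, (pi / 2)%R])
      (pi^-1 * (2 * cos t ^+ 2))%:E)%E.
    apply: eq_integral => t; rewrite inE/= in_itv/= => tpi; congr EFin.
    transitivity (semicircle_pdf (s2 * sin t) * (s2 * cos t)); first by [].
    rewrite /semicircle_pdf.
    have -> : 2 - (s2 * sin t) ^+ 2 = 2 * cos t ^+ 2.
      by rewrite exprMn sqr_sqrtr// sin2cos2; ring.
    rewrite sqrtrM// sqrtr_sqr ger0_norm ?cos_ge0_pihalf//.
    have h : s2 * s2 = 2 by rewrite -expr2 sqr_sqrtr.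
    by rewrite -[in RHS]h; move: (cos t) => c; ring.
  rewrite (@continuous_FTC2 _ (fun t : R => pi^-1 * (2 * cos t ^+ 2))
    (fun t : R => pi^-1 * (t + sin t * cos t))).
  + rewrite cosN cos_pihalf !mulr0 !addr0 -EFinB; congr EFin.
    have h (p : R) : p != 0 -> p^-1 * (p / 2) - p^-1 * - (p / 2) = 1.
      by move=> p0; field.
    exact: h.
  + have := @pi_gt0 R; lra.
  + apply: continuous_subspaceT => t; apply: cvgM; first exact: cvg_cst.
    apply: cvgM; first exact: cvg_cst.
    apply: (@continuous_comp _ _ _ (@cos R) (fun x => x ^+ 2)).
      exact: continuous_cos.
    exact: exprn_continuous.
  + exact: derivable_LR is_derive_prim.
  + by move=> t _; rewrite derive1E; apply: derive_val.
- move=> x y xI yI xy; rewrite ltr_pM2l ?sqrtr_gt0//.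
  by rewrite ltr_sin.
- by rewrite derive1_sub => t _; exact: continuous_dsub.
- rewrite derive1_sub; apply/cvg_ex; eexists.
  exact/cvg_at_right_filter/continuous_dsub.
- rewrite derive1_sub; apply/cvg_ex; eexists.
  exact/cvg_at_left_filter/continuous_dsub.
- exact: derivable_LR is_derive_sub.
- exact/continuous_subspaceT/continuous_semicircle_pdf.
Qed.

HB.instance Definition _ :=
  @Measure_isProbability.Build _ _ R semicircle semicircle_setT.

Definition mu1 : set (R * R) -> \bar R := (\d_(0%R : R) \x semicircle)%E.

HB.instance Definition _ := Measure.on mu1.

Let mu1_setT : mu1 [set: R * R] = 1%E.
Proof.
rewrite /mu1 -setXTT product_measure1E//= diracT mul1e.
exact: semicircle_setT.
Qed.

HB.instance Definition _ :=
  @Measure_isProbability.Build _ _ R mu1 mu1_setT.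

End semicircle_law.

(* Main.v *)
From HB Require Import structures.
Require Import Defs.
From mathcomp Require Import all_boot all_order all_algebra.
From mathcomp Require Import all_classical all_reals all_analysis measurable_realfun.
From mathcomp Require Import ring lra.

(* Averaging over the directions f, with weight sin^2 f, the logarithmic kernel
   - log|p - q| + (p^2 + q^2) / 2 of the projections x.2 + x.1 * cot f gives the
   planar kernel. Hence I1 mu is an average of the one-dimensional log-gas
   energies of the projected laws of mu. The semicircle law is the unique
   minimiser of the one-dimensional energy: its potential is constant on its
   support and not smaller elsewhere, and the logarithmic kernel is
   conditionally positive definite, because - log|t| is, up to constants, the
   limit of the Gram kernels \int_0^S max (r - |t|) 0 / r^2 dr as S grows.
   Every projection of mu1 is the semicircle law, so mu1 is a minimiser. For
   any other minimiser almost every projection is the semicircle law; the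
   directions tending to 0 then force x.1 = 0 almost surely, after which a
   single projection determines the measure. *)

Set Implicit Arguments.
Unset Strict Implicit.
Unset Printing Implicit Defensive.

Import Order.TTheory GRing.Theory Num.Theory.
Import numFieldNormedType.Exports.

Local Open Scope classical_set_scope.
Local Open Scope ring_scope.

(** The anisotropy of [W1] comes from the rescaling of the projections. For a nonzero [d] of length
    [r] making the angle [a] with the second axis, [sin f * proj f d] is [r * sin (f - a)] up to
    sign, so the logarithm splits into [- ln r], [- ln |sin (f - a)|] and [ln (sin f)]. Against the
    weight [sin f ^+ 2] the last two average to [sin a ^+ 2], which is [d.1 ^+ 2 / r ^+ 2]. The
    obstacle is that energies may be infinite and cannot be subtracted. Adding the confinement to
    the logarithm makes the kernel [k1] nonnegative, so Tonelli and monotone convergence apply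
    directly, and comparisons are written with sums on both sides. The Gram kernels exceed [- ln t]
    by a constant that diverges with the cutoff; it is the same for the two cross interactions and
    the two self interactions of a pair of laws, hence it cancels. The other excess, [t / S], is
    unbounded in [t] but dominated by a vanishing multiple of [k1 + 3]. The squared distance at a
    fixed cutoff is kept in the final inequality, so that uniqueness comes out together with
    minimality. *)

(** * Fundamental theorem of calculus with endpoint singularities *)

Section singular_ftc.
Context {R : realType}.
Local Notation leb := (@lebesgue_measure R).
Implicit Types (f F : R -> R) (a b K : R).

Lemma derivable_oo_LRcontinuousT F (a b c d : R) : c < d ->
  {in `]a, b[, forall x, derivable F (x : R) 1} -> continuous F -> a <= c -> d <= b ->
  derivable_oo_LRcontinuous F c d.
Proof.
move=> cd dF cF ac db; split.
- move=> x; rewrite in_itv/= => /andP[cx xd]; apply: dF.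
  by rewrite in_itv/= (le_lt_trans ac cx) (lt_le_trans xd db).
- exact/cvg_at_right_filter/cF.
- exact/cvg_at_left_filter/cF.
Qed.

(** Only the primitive has to be continuous at the endpoints, where [f] may blow up: the usual
    theorem is applied on compact intervals exhausting []a, b[], and monotone convergence gives the
    limit. *)
Lemma ge0_integral_itvoo f F a b : a < b -> continuous F ->
  {in `]a, b[, forall x, is_derive (x : R) (1 : R) F (f x)} ->
  {in `]a, b[, continuous f} ->
  {in `]a, b[, forall x, 0 <= f x} ->
  (\int[leb]_(x in `]a, b[) (f x)%:E = (F b - F a)%:E)%E.
Proof.
move=> ab cF dF cf f0.
(* The division by 3 keeps [a + e n < b - e n] already at [n = 0]. *)
pose e (n : nat) : R := (b - a) / 3 / n.+1%:R.
have ba3 : 0 < (b - a) / 3 by rewrite divr_gt0// subr_gt0.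
have e0 n : 0 < e n by rewrite divr_gt0.
have e1 n : e n <= (b - a) / 3.
  by rewrite /e -[leRHS]mulr1 ler_pM2l// invf_le1// ler1n.
have ecvg : e n @[n --> \oo] --> 0.
  rewrite -(mulr0 ((b - a) / 3)); apply: cvgM; first exact: cvg_cst.
  exact: cvg_harmonic.
pose I n := `[a + e n, b - e n]%classic.
have Ilt n : a + e n < b - e n by have := e1 n; lra.
have IU : \bigcup_n I n = `]a, b[%classic.
  apply/seteqP; split => [x [n _]|x].
    rewrite /I/= !in_itv/= => /andP[ax xb]; have := e0 n.
    by move=> en0; apply/andP; split; lra.
  rewrite /= in_itv/= => /andP[ax xb].
  have : \forall n \near \oo, e n < Num.min (x - a) (b - x).
    have m0 : 0 < Num.min (x - a) (b - x) by rewrite lt_min !subr_gt0 ax xb.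
    move/cvgrPdist_lt : ecvg => /(_ _ m0); apply: filterS => n.
    by rewrite sub0r normrN gtr0_norm.
  move=> [n _ /(_ n (leqnn _))]; rewrite lt_min => /andP[h1 h2].
  by exists n => //; rewrite /I/= in_itv/=; apply/andP; split; lra.
have II n : I n `<=` `]a, b[ by rewrite -IU; exact: bigcup_sup.
have mf : measurable_fun `]a, b[ (EFin \o f).
  apply/measurable_EFinP; apply: open_continuous_measurable_fun.
    exact: itv_open.
  by move=> x; rewrite inE => xab; exact: cf.
have := @ge0_nondecreasing_set_cvg_integral _ (measurableTypeR R) R I (EFin \o f) leb.
rewrite IU => /(_ _ _ _ _)/cvg_lim <- //; last 4 first.
- move=> m n mn; apply/subsetPset => x.
  have : e n <= e m.
    by rewrite ler_pM2l// lef_pV2 ?posrE// ler_nat ltnS.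
  by rewrite /I/= !in_itv/= => emn /andP[? ?]; apply/andP; split; lra.
- by move=> n; exact: measurable_itv.
- by move=> n; apply: measurable_funS mf => //; exact: II.
- by move=> n x /II xab; rewrite lee_fin f0//.
have -> : (fun n => \int[leb]_(x in I n) (f x)%:E)%E =
    (fun n => (F (b - e n) - F (a + e n))%:E).
  apply/funext => n; rewrite (@continuous_FTC2 _ f F)//.
  - apply: continuous_in_subspaceT => x.
    by rewrite inE => /II xab; exact: cf.
  - apply: (@derivable_oo_LRcontinuousT _ a b) => //.
    + by move=> x /dF; case.
    + by have := e0 n; lra.
    + by have := e0 n; lra.
  - move=> x xI; rewrite derive1E; apply: derive_val.
    by apply: dF; apply: (II n); apply: subset_itv_oo_cc xI.
apply/cvg_lim => //; apply: cvg_EFin; first exact: nearW.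
apply: cvgB.
- apply: (cvg_comp (fun n => b - e n) F _ (cF b)).
  by rewrite -[X in _ `=>` nbhs X](subr0 b); apply: cvgB => //; exact: cvg_cst.
- apply: (cvg_comp (fun n => a + e n) F _ (cF a)).
  by rewrite -[X in _ `=>` nbhs X](addr0 a); apply: cvgD => //; exact: cvg_cst.
Qed.

(** Adding [K] reduces to the nonnegative case, and the finite value obtained there is what proves
    integrability. *)
Lemma bounded_below_integral_itvoo f F a b K : a < b -> continuous F ->
  {in `]a, b[, forall x, is_derive (x : R) (1 : R) F (f x)} ->
  {in `]a, b[, continuous f} ->
  {in `]a, b[, forall x, - K <= f x} ->
  leb.-integrable `]a, b[ (EFin \o f) /\
  (\int[leb]_(x in `]a, b[) (f x)%:E = (F b - F a)%:E)%E.
Proof.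
move=> ab cF dF cf fK.
have mf : measurable_fun `]a, b[ (EFin \o f).
  apply/measurable_EFinP; apply: open_continuous_measurable_fun.
    exact: itv_open.
  by move=> x; rewrite inE => xab; exact: cf.
have leb_ab : (leb `]a, b[ < +oo)%E.
  by rewrite lebesgue_measure_itv/= lte_fin ab ltry.
have fKE : (\int[leb]_(x in `]a, b[) (f x + K)%:E =
    ((F b + K * b) - (F a + K * a))%:E)%E.
  apply: (@ge0_integral_itvoo (fun x => f x + K) (fun x => F x + K * x)) => //.
  - move=> x; apply: cvgD; first exact: cF.
    by apply: cvgM; [exact: cvg_cst|exact: cvg_id].
  - move=> x xab; apply: is_deriveD; first exact: dF.
    rewrite -[K in is_derive _ _ _ K]mulr1.
    exact: (is_deriveZ K (is_derive_id x (1 : R))).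
  - by move=> x xab; apply: cvgD; [exact: cf|exact: cvg_cst].
  - by move=> x xab; have := fK x xab; lra.
have iK : leb.-integrable `]a, b[ (EFin \o cst K).
  by apply: measurable_bounded_integrable => //; exact: bounded_cst.
have ifK : leb.-integrable `]a, b[ (EFin \o (fun x => f x + K)).
  apply/integrableP; split.
    by apply/measurable_EFinP/measurable_funD => //; exact/measurable_EFinP.
  under eq_integral => x xab.
    rewrite /= ger0_norm; last first.
      by rewrite inE in xab; have := fK x xab; lra.
    over.
  by rewrite fKE ltry.
have ffK : (EFin \o f = (EFin \o (fun x => f x + K)%R) \- (EFin \o cst K))%E.
  by apply/funext => x /=; rewrite -EFinB addrK.
split; first by rewrite ffK; exact: integrableB.
transitivity (\int[leb]_(x in `]a, b[) ((EFin \o (fun x => f x + K)%R) \- (EFin \o cst K)) x)%E.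
  by rewrite -ffK.
rewrite integralB// fKE /= integral_cst//= lebesgue_measure_itv/= lte_fin ab.
by congr EFin; ring.
Qed.

End singular_ftc.

(** * Translation invariance and integrals of periodic functions *)

Section translation.
Context {R : realType}.
Local Notation leb := (@lebesgue_measure R).
Local Open Scope ereal_scope.
Implicit Types (f : R -> \bar R) (a b c T : R).

Definition translation c : measurableTypeR R -> measurableTypeR R :=
  fun x => (x + c)%R.

Let measurable_translation c : measurable_fun setT (translation c).
Proof. exact: measurable_funD. Qed.

HB.instance Definition _ c :=
  isMeasurableFun.Build _ _ _ _ (translation c) (measurable_translation c).

Lemma lebesgue_measure_translation c (A : set R) : measurable A ->
  pushforward leb (translation c) A = leb A.
Proof.
move=> mA; apply/esym/lebesgue_measure_unique => //= _ [[a b]] _ <-.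
rewrite /pushforward /translation.
rewrite (_ : _ @^-1` _ = `](a - c)%R, (b - c)%R]%classic).
  rewrite !lebesgue_measure_itv/= !lte_fin ltrBlDr subrK; case: ifPn => // _.
  by congr EFin; ring.
by apply/seteqP; split => x; rewrite /= !in_itv/= ltrBlDr lerBrDr.
Qed.

Lemma ge0_integral_itvco_shift f a b c : measurable_fun [set: R] f ->
  (forall x, 0 <= f x) ->
  \int[leb]_(x in `[a, b[) f (x + c)%R =
  \int[leb]_(x in `[(a + c)%R, (b + c)%R[) f x.
Proof.
move=> mf f0.
rewrite (_ : `[a, b[%classic =
    (translation c) @^-1` `[(a + c)%R, (b + c)%R[); last first.
  by apply/seteqP; split => x; rewrite /= !in_itv/= lerD2r ltrD2r.
rewrite -(@ge0_integral_pushforward _ _ _ _ R (translation c) _ leb _ f)//=;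
  last exact: measurable_funS mf.
by apply: eq_measure_integral => //= A mA AS; exact/lebesgue_measure_translation.
Qed.

Lemma ge0_integral_itvco_split f a b c : (a <= b)%R -> (b <= c)%R ->
  measurable_fun [set: R] f -> (forall x, 0 <= f x) ->
  \int[leb]_(x in `[a, c[) f x =
  \int[leb]_(x in `[a, b[) f x + \int[leb]_(x in `[b, c[) f x.
Proof.
move=> ab bc mf f0.
rewrite (@itv_bndbnd_setU _ _ _ (BLeft b)) ?bnd_simp//.
rewrite ge0_integral_setU//=.
- exact: measurable_funTS.
- apply/disj_setPS => x /=; rewrite !in_itv/= => -[/andP[_ xb] /andP[bx _]].
  by move: (lt_le_trans xb bx); rewrite ltxx.
Qed.

(** The integral over [[a, T + a[] is cut at [T] and the piece beyond [T] is moved back by one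
    period. This serves to bring an interior singularity to the endpoints. *)
Lemma ge0_integral_periodic f T a : (0 <= a <= T)%R -> (forall x, f (x + T)%R = f x) ->
  measurable_fun [set: R] f -> (forall x, 0 <= f x) ->
  \int[leb]_(x in `[0%R, T[) f (x + a)%R = \int[leb]_(x in `[0%R, T[) f x.
Proof.
move=> /andP[a0 aT] fT mf f0; rewrite ge0_integral_itvco_shift// add0r.
rewrite (@ge0_integral_itvco_split f a T (T + a)%R) ?lerDl//.
rewrite (@ge0_integral_itvco_split f 0 a T)// addeC; congr (_ + _).
transitivity (\int[leb]_(x in `[0%R, a[) f (x + T)%R).
  by rewrite ge0_integral_itvco_shift// add0r [(a + T)%R]addrC.
by apply: eq_integral => x _.
Qed.

End translation.

(** * The function [x * ln x] and integration by parts against [ln (sin y)] *)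

Section log_sine.
Context {R : realType}.
Local Notation leb := (@lebesgue_measure R).
Implicit Types (x y a : R).

Lemma mulr_lnN_le1 x : 0 < x -> x * - ln x <= 1.
Proof.
move=> x0; rewrite -lnV ?posrE// -(divff (lt0r_neq0 x0)) ler_pM2l//.
by rewrite ltW// ln_sublinear// invr_gt0.
Qed.

(** With [r = Num.sqrt x], [x * ln x] is [2 * r * (r * ln r)] and [r * - ln r <= 1]; the bound by a
    square root yields the limit 0 at 0. *)
Lemma norm_xlnx_le x : x < 1 -> `|x * ln x| <= 2 * Num.sqrt `|x|.
Proof.
move=> x1; have [x0|x0] := leP x 0.
  by rewrite ln0// mulr0 normr0 mulr_ge0// sqrtr_ge0.
have r0 : 0 < Num.sqrt x by rewrite sqrtr_gt0.
have xE : x = Num.sqrt x ^+ 2 by rewrite sqr_sqrtr// ltW.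
have lx : ln x < 0 by rewrite ln_lt0// x0.
have h := mulr_lnN_le1 r0.
rewrite (gtr0_norm x0) ltr0_norm ?pmulr_rlt0//.
move: lx; rewrite {1 2 3}xE lnXn//.
move: (Num.sqrt x) (ln (Num.sqrt x)) r0 h => r l r0 h _.
have : r * (r * - l) <= r * 1 by rewrite ler_pM2l.
lra.
Qed.

(** The default value [ln x = 0] for [x <= 0] makes the function vanish on the left half line, so
    that its composition with [sin] is continuous everywhere, whatever the sign of [sin]. *)
Lemma continuous_xlnx : continuous (fun x : R => x * ln x).
Proof.
move=> x; have [x0|x0|->] := ltgtP x 0.
- rewrite /continuous_at (ln0 (ltW x0)) mulr0; apply: cvg_near_cst.
  near=> y; rewrite ln0 ?mulr0//.
  by rewrite ltW//; near: y; exact: lt_nbhsl.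
- by apply: cvgM; [exact: cvg_id|exact: continuous_ln].
- rewrite /continuous_at mul0r; apply/norm_cvg0P.
  apply: (@squeeze_cvgr _ _ _ _ (cst 0) (fun y => 2 * Num.sqrt `|y|)).
  + near=> y; rewrite normr_ge0/=; apply: norm_xlnx_le.
    by near: y; exact: lt_nbhsl.
  + exact: cvg_cst.
  + have h : Num.sqrt `|y| @[y --> (0 : R)] --> Num.sqrt `|0 : R|.
      exact: (cvg_comp _ _ (@norm_continuous _ R 0) (@sqrt_continuous R _)).
    rewrite normr0 sqrtr0 in h.
    rewrite -[X in _ `=>` nbhs X](mulr0 (2 : R)).
    by apply: cvgM; first exact: cvg_cst.
Unshelve. all: end_near. Qed.

(* The primitive of [g * - ln sin], where [g] is the derivative of [sin * H],
   is continuous up to the endpoints because [x * ln x] is. *)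
Lemma log_sine_by_parts (H dH P g : R -> R) K :
  (forall y, is_derive y 1 H (dH y)) ->
  (forall y, is_derive y 1 P (H y * cos y)) ->
  (forall y, g y = cos y * H y + sin y * dH y) -> continuous dH ->
  {in `]0, pi[, forall y, - K <= g y * - ln (sin y)} ->
  leb.-integrable `]0, pi[ (EFin \o (fun y => g y * - ln (sin y))) /\
  (\int[leb]_(y in `]0%R, pi[) (g y * - ln (sin y))%:E = (P pi - P 0)%:E)%E.
Proof.
move=> dHP dPP gE cdH gK.
have cH : continuous H.
  by move=> y; apply/differentiable_continuous/derivable1_diffP; case: (dHP y).
have cP : continuous P.
  by move=> y; apply/differentiable_continuous/derivable1_diffP; case: (dPP y).
have cg : continuous g.
  rewrite (_ : g = fun y => cos y * H y + sin y * dH y); last exact/funext.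
  move=> y; apply: cvgD; apply: cvgM; [exact: continuous_cos|exact: cH|
    exact: continuous_sin|exact: cdH].
have csl : continuous ((fun x : R => x * ln x) \o sin).
  move=> y; apply: continuous_comp; [exact: continuous_sin|exact: continuous_xlnx].
pose F y := P y - H y * (sin y * ln (sin y)).
have -> : P pi - P 0 = F pi - F 0 by rewrite /F sinpi sin0 !mul0r !mulr0 !subr0.
apply: (bounded_below_integral_itvoo (K := K)); first exact: pi_gt0.
- move=> y; apply: cvgB; first exact: cP.
  apply: cvgM; first exact: cH.
  exact: csl.
- move=> y; rewrite in_itv/= => ypi; have s0 := sin_gt0_pi ypi.
  have dl : is_derive y 1 (fun y => ln (sin y)) ((sin y)^-1 * cos y).
    by apply: (@is_derive1_comp _ (@ln R) (@sin R)); exact: is_derive1_ln.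
  apply: is_derive_eq; rewrite /GRing.scale/= gE.
  have := lt0r_neq0 s0; move: (sin y) (cos y) (ln (sin y)) => s c l s0'.
  by field.
- move=> y; rewrite in_itv/= => ypi; have s0 := sin_gt0_pi ypi.
  apply: cvgM; first exact: cg.
  apply: cvgN; apply: (@continuous_comp _ _ _ (@sin R) (@ln R)).
    exact: continuous_sin.
  exact: continuous_ln.
- exact: gK.
Qed.

End log_sine.

(** * Log-sine integrals *)

Section log_sine_integrals.
Context {R : realType}.
Local Notation leb := (@lebesgue_measure R).
Implicit Types (x y a : R).

Let sin01 y : 0 < y < pi -> 0 < sin y <= 1.
Proof. by move=> /sin_gt0_pi ->; rewrite sin_le1. Qed.

Let lnsin_bound y : 0 < y < pi -> 0 <= - ln (sin y) /\ sin y * - ln (sin y) <= 1.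
Proof.
move=> /sin01/andP[s0 s1]; split; first by rewrite oppr_ge0 ln_le0.
exact: mulr_lnN_le1.
Qed.

Let cos2E y : cos y ^+ 2 = 1 - sin y ^+ 2. Proof. exact: cos2sin2. Qed.

Let continuousX (f : R -> R) n : continuous f -> continuous (fun y => f y ^+ n).
Proof.
move=> cf y; apply: (@continuous_comp _ _ _ f (fun x => x ^+ n)); first exact: cf.
exact: exprn_continuous.
Qed.

(** The factor is [cos (2 y)]. This and the next three lemmas give Fourier coefficients of
    [- ln (sin y)]: [pi / (2 k)] against [cos (2 k y)] and 0 against [sin (2 k y)], for [k = 1, 2].
    In each, [H] is chosen so that [sin y * H y] is a primitive of the factor vanishing at both
    endpoints. *)
Lemma integral_cos2_lnsin :
  let f y := (cos y ^+ 2 - sin y ^+ 2) * - ln (sin y) in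
  leb.-integrable `]0, pi[ (EFin \o f) /\
  (\int[leb]_(y in `]0%R, pi[) (f y)%:E = (pi / 2)%:E)%E.
Proof.
have [] := @log_sine_by_parts R cos (fun y => - sin y)
  (fun y => 2^-1 * (y + sin y * cos y)) (fun y => cos y ^+ 2 - sin y ^+ 2) 2.
- move=> y; apply: is_derive_eq; rewrite /GRing.scale/=.
  by have := cos2E y; move: (sin y) (cos y) => s c; lra.
- by move=> y; ring.
- by move=> y; apply: cvgN; exact: continuous_sin.
- move=> y; rewrite in_itv/= => ypi.
  have [l0 l1] := lnsin_bound ypi; have /andP[s0 s1] := sin01 ypi.
  have := cos2E y; move: (sin y) (cos y) (- ln (sin y)) s0 s1 l0 l1 => s c l s0 s1 l0 l1 ->.
  nra.
by move=> i E /=; split => //; rewrite E; congr EFin; rewrite sinpi sin0; lra.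
Qed.

Lemma integral_sin2_lnsin :
  let f y := (2 * sin y * cos y) * - ln (sin y) in
  leb.-integrable `]0, pi[ (EFin \o f) /\
  (\int[leb]_(y in `]0%R, pi[) (f y)%:E = 0%:E)%E.
Proof.
have [] := @log_sine_by_parts R sin cos
  (fun y => 2^-1 * (sin y) ^+ 2) (fun y => 2 * sin y * cos y) 2.
- move=> y; apply: is_derive_eq; rewrite /GRing.scale/=.
  by move: (sin y) (cos y) => s c; lra.
- by move=> y; ring.
- exact: continuous_cos.
- move=> y; rewrite in_itv/= => ypi.
  have [l0 l1] := lnsin_bound ypi; have /andP[s0 s1] := sin01 ypi.
  have := cos_geN1 y; have := cos_le1 y.
  move: (sin y) (cos y) (- ln (sin y)) s0 s1 l0 l1 => s c l s0 s1 l0 l1 c1 c2.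
  have : 0 <= s * l by rewrite mulr_ge0// ltW.
  nra.
by move=> i E /=; split => //; rewrite E; congr EFin; rewrite sinpi sin0; lra.
Qed.

(** The factor is [cos (4 y)], as a Chebyshev polynomial in [cos y], and [sin y * H y] is
    [sin (4 y) / 4]. *)
Lemma integral_cos4_lnsin :
  let f y := (8 * cos y ^+ 4 - 8 * cos y ^+ 2 + 1) * - ln (sin y) in
  leb.-integrable `]0, pi[ (EFin \o f) /\
  (\int[leb]_(y in `]0%R, pi[) (f y)%:E = (pi / 4)%:E)%E.
Proof.
have [] := @log_sine_by_parts R (fun y => 2 * cos y ^+ 3 - cos y)
  (fun y => sin y - 6 * cos y ^+ 2 * sin y)
  (fun y => 4^-1 * y + 2^-1 * (sin y * cos y)
            + 4^-1 * (sin y * cos y * (cos y ^+ 2 - sin y ^+ 2)))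
  (fun y => 8 * cos y ^+ 4 - 8 * cos y ^+ 2 + 1) 8.
- move=> y; apply: is_derive_eq; rewrite /GRing.scale/=.
  by move: (sin y) (cos y) => s c; ring.
- move=> y; apply: is_derive_eq; rewrite /GRing.scale/=.
  have : sin y ^+ 2 = 1 - cos y ^+ 2 by exact: sin2cos2.
  move: (sin y) (cos y) => s c h.
  have h4 : s ^+ 4 = (1 - c ^+ 2) ^+ 2 by rewrite -h; ring.
  have h2 : s ^+ 2 * c ^+ 2 = (1 - c ^+ 2) * c ^+ 2 by rewrite -h.
  lra.
- move=> y.
  have : sin y ^+ 2 = 1 - cos y ^+ 2 by exact: sin2cos2.
  by move: (sin y) (cos y) => s c h; ring: h.
- move=> y; apply: cvgB; first exact: continuous_sin.
  apply: cvgM; last exact: continuous_sin.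
  by apply: cvgM; [exact: cvg_cst|exact/continuousX/continuous_cos].
- move=> y; rewrite in_itv/= => ypi.
  have [l0 l1] := lnsin_bound ypi; have /andP[s0 s1] := sin01 ypi.
  rewrite (_ : cos y ^+ 4 = (cos y ^+ 2) ^+ 2); last by rewrite -exprM.
  have := cos2E y.
  move: (sin y) (cos y) (- ln (sin y)) s0 s1 l0 l1 => s c l s0 s1 l0 l1 ->.
  (* Only the product [s * l] is bounded, by 1. The lone [l] and the last term are nonnegative, and
     the middle term is at least [- 8], whence the constant 8. *)
  have -> : (8 * (1 - s ^+ 2) ^+ 2 - 8 * (1 - s ^+ 2) + 1) * l =
    l - 8 * (s * l) * s + 8 * (s * s * s) * (s * l) by ring.
  have : 0 <= 8 * (s * s * s) * (s * l) by rewrite !mulr_ge0// ltW.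
  nra.
by move=> i E /=; split => //; rewrite E; congr EFin; rewrite sinpi sin0; lra.
Qed.

(** The factor is [sin (4 y)], and [sin y * H y] is its primitive [(1 - cos (4 y)) / 4]. *)
Lemma integral_sin4_lnsin :
  let f y := (4 * sin y * cos y * (cos y ^+ 2 - sin y ^+ 2)) * - ln (sin y) in
  leb.-integrable `]0, pi[ (EFin \o f) /\
  (\int[leb]_(y in `]0%R, pi[) (f y)%:E = 0%:E)%E.
Proof.
have [] := @log_sine_by_parts R (fun y => 2 * (sin y * cos y ^+ 2))
  (fun y => 2 * (cos y ^+ 3 - 2 * (sin y ^+ 2 * cos y)))
  (fun y => - 2^-1 * (cos y) ^+ 4)
  (fun y => 4 * sin y * cos y * (cos y ^+ 2 - sin y ^+ 2)) 4.
- move=> y; apply: is_derive_eq; rewrite /GRing.scale/=.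
  by move: (sin y) (cos y) => s c; ring.
- move=> y; apply: is_derive_eq; rewrite /GRing.scale/=.
  by move: (sin y) (cos y) => s c; field.
- by move=> y; ring.
- move=> y; apply: cvgM; first exact: cvg_cst.
  apply: cvgB; first exact/continuousX/continuous_cos.
  apply: cvgM; first exact: cvg_cst.
  by apply: cvgM; [exact/continuousX/continuous_sin|exact: continuous_cos].
- move=> y; rewrite in_itv/= => ypi.
  have [l0 l1] := lnsin_bound ypi; have /andP[s0 s1] := sin01 ypi.
  have := cos_geN1 y; have := cos_le1 y; have := cos2E y.
  move: (sin y) (cos y) (- ln (sin y)) s0 s1 l0 l1 => s c l s0 s1 l0 l1 -> c1 c2.
  have sl : 0 <= s * l by rewrite mulr_ge0// ltW.
  have d : -1 <= c * (1 - s ^+ 2 - s ^+ 2).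
    have : `|c * (1 - s ^+ 2 - s ^+ 2)| <= 1 * 1.
      rewrite normrM ler_pM//; first by rewrite ler_norml c1 c2.
      by rewrite ler_norml; apply/andP; split; nra.
    by rewrite mulr1 ler_norml => /andP[].
  have -> : 4 * s * c * (1 - s ^+ 2 - s ^+ 2) * l =
    4 * ((s * l) * (c * (1 - s ^+ 2 - s ^+ 2))) by ring.
  nra.
by move=> i E /=; split => //; rewrite E; congr EFin; rewrite cospi cos0; lra.
Qed.

(** Since [cos (2 y) + 2 * sin y ^+ 2 = 1], the function is the sum of the integrable product with
    [cos (2 y)] and of a product bounded by 2. *)
Lemma integrable_lnsin : leb.-integrable `]0, pi[ (EFin \o (fun y => - ln (sin y))).
Proof.
have [i _] := integral_cos2_lnsin.
have mln : measurable_fun `]0, pi[ (fun y : R => - ln (sin y)).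
  apply: measurable_funTS; apply: measurableT_comp => //.
  apply: measurableT_comp; first exact: measurable_ln.
  by apply: continuous_measurable_fun; exact: continuous_sin.
have j : leb.-integrable `]0, pi[ (EFin \o (fun y => 2 * sin y ^+ 2 * - ln (sin y))).
  apply: measurable_bounded_integrable => //.
  - by rewrite /= lebesgue_measure_itv/= lte_fin pi_gt0 ltry.
  - apply: measurable_funM => //; apply: measurable_funTS.
    apply: continuous_measurable_fun => y; apply: cvgM; first exact: cvg_cst.
    exact/continuousX/continuous_sin.
  - exists 2; split => // M M2 y /=; rewrite in_itv/= => ypi.
    have [l0 l1] := lnsin_bound ypi; have /andP[s0 s1] := sin01 ypi.
    apply: (le_trans _ (ltW M2)); rewrite ger0_norm.
      by nra.
    by rewrite mulr_ge0// mulr_ge0// sqr_ge0.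
apply: eq_integrable (integrableD _ i j) => //.
move=> y _ /=; rewrite -EFinD; congr EFin; rewrite -mulrDl cos2E.
by rewrite (_ : _ - _ + _ = 1) ?mul1r//; lra.
Qed.

End log_sine_integrals.

(** * The logarithmic kernel and its integrals against trigonometric weights *)

Section nlog.
Context {R : realType}.
Local Notation leb := (@lebesgue_measure R).
Implicit Types (x y a : R).
Local Open Scope ereal_scope.

(** The test overrides the default [ln 0 = 0]. As [-oo] is never a value, sums of such terms are
    unambiguous and [nlogM] holds for zero factors too. *)
Definition nlog x : \bar R := if x == 0%R then +oo else (- ln `|x|)%:E.

Lemma nlogM x y : nlog (x * y)%R = nlog x + nlog y.
Proof.
rewrite /nlog mulf_eq0; case: eqVneq => [->|x0] /=; first by case: ifP.
case: (eqVneq y 0%R) => [//|y0] /=.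
by rewrite normrM lnM ?posrE ?normr_gt0// opprD.
Qed.

Lemma nlogN x : nlog (- x)%R = nlog x.
Proof. by rewrite /nlog oppr_eq0 normrN. Qed.

Lemma nlog_ge x : (1 - `|x|)%:E <= nlog x.
Proof.
rewrite /nlog; case: eqVneq => [_|x0]; first exact: leey.
rewrite lee_fin; have := @le_ln1Dx R (`|x| - 1).
rewrite addrCA subrr addr0 ltrBrDr addNr normr_gt0 => /(_ x0); lra.
Qed.

Lemma nlog_ge0 x : (`|x| <= 1)%R -> 0 <= nlog x.
Proof. by move=> x1; apply: le_trans (nlog_ge x); rewrite lee_fin subr_ge0. Qed.

Lemma measurable_nlog : measurable_fun [set: R] nlog.
Proof.
apply: measurable_fun_if => //.
- apply: (measurable_fun_bool true).
  rewrite setTI (_ : _ @^-1` _ = [set 0%R])//.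
  by apply/seteqP; split => x /=; [move/eqP|move=> ->; rewrite eqxx].
- apply/measurable_EFinP/measurable_funTS.
  apply: measurableT_comp => //; apply: measurableT_comp; first exact: measurable_ln.
  exact: normr_measurable.
Qed.

(** Its value is [pi * ln 2]; it is kept symbolic, as it cancels in [integral_k1_proj] and otherwise
    only enters the constant [potential_min]. *)
Definition lnsin_const : R := fine (\int[leb]_(y in `]0%R, pi[) (- ln (sin y))%:E).

Lemma integral_lnsin : \int[leb]_(y in `]0%R, pi[) (- ln (sin y))%:E = lnsin_const%:E.
Proof.
by rewrite /lnsin_const fineK//; apply: integrable_fin_num => //; exact: integrable_lnsin.
Qed.

(** Shifting by [a] moves the zero of [sin (y - a)] to the endpoints and expands the weight into a
    constant and two harmonics [g1], [g2]. In the applications these are a cosine and a sine of the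
    same multiple angle, and [A], [B] are their values at [a]. *)
Lemma integral_periodic_nlog_sin (g g1 g2 : R -> R) A B I1 a : (0 <= a <= pi)%R ->
  continuous g -> (forall y, 0 <= g y)%R -> (forall y, g (y + pi) = g y)%R ->
  (forall y, g (y + a) = 2^-1 - 2^-1 * A * g1 y + 2^-1 * B * g2 y)%R ->
  leb.-integrable `]0%R, pi[ (EFin \o (fun y => g1 y * - ln (sin y))%R) /\
    \int[leb]_(y in `]0%R, pi[) (g1 y * - ln (sin y))%:E = I1%:E ->
  leb.-integrable `]0%R, pi[ (EFin \o (fun y => g2 y * - ln (sin y))%R) /\
    \int[leb]_(y in `]0%R, pi[) (g2 y * - ln (sin y))%:E = 0%:E ->
  \int[leb]_(y in `[0%R, pi[) ((g y)%:E * nlog (sin (y - a))) =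
  (2^-1 * lnsin_const - 2^-1 * A * I1)%:E.
Proof.
move=> api cg g0 gpi gE [i1 E1] [i2 E2].
have mf : measurable_fun [set: R] (fun y => (g y)%:E * nlog (sin (y - a)%R)).
  apply: emeasurable_funM.
    by apply/measurable_EFinP; exact: continuous_measurable_fun.
  apply: measurableT_comp; first exact: measurable_nlog.
  apply: measurableT_comp; last exact: measurable_funB.
  by apply: continuous_measurable_fun; exact: continuous_sin.
rewrite -(@ge0_integral_periodic _ _ pi a)//; last 2 first.
- by move=> y; rewrite gpi addrAC sinDpi nlogN.
- by move=> y; rewrite mule_ge0 ?lee_fin// nlog_ge0// sin_max.
rewrite integral_itv_bndoo; last first.
  apply: measurable_funTS; apply: (measurableT_comp mf).
  exact: measurable_funD.
pose h (c : R) (k : R -> R) := fun y => (c * (k y * - ln (sin y)))%:E.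
have ih c k : leb.-integrable `]0%R, pi[ (EFin \o (fun y => k y * - ln (sin y))%R) ->
    leb.-integrable `]0%R, pi[ (h c k).
  by move=> ik; apply: eq_integrable (integrableZl _ c ik).
have Ih c k J : leb.-integrable `]0%R, pi[ (EFin \o (fun y => k y * - ln (sin y))%R) ->
    \int[leb]_(y in `]0%R, pi[) (k y * - ln (sin y))%:E = J%:E ->
    \int[leb]_(y in `]0%R, pi[) h c k y = (c * J)%:E.
  move=> ik kJ; under eq_integral do rewrite /h EFinM.
  by rewrite (@integralZl _ _ _ _ _ _ _ ik)//= kJ.
have i0 : leb.-integrable `]0%R, pi[ (EFin \o (fun y => cst 1 y * - ln (sin y))%R).
  by apply: eq_integrable integrable_lnsin => //= y _; rewrite mul1r.
have E0 : \int[leb]_(y in `]0%R, pi[) (cst 1 y * - ln (sin y))%:E = lnsin_const%:E.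
  by rewrite -integral_lnsin; apply: eq_integral => y _; rewrite mul1r.
transitivity (\int[leb]_(y in `]0%R, pi[)
    (h (2^-1)%R (cst 1%R) y + h (- (2^-1 * A))%R g1 y + h (2^-1 * B)%R g2 y)).
  apply: eq_integral => y; rewrite inE/= in_itv/= => ypi.
  have s0 := sin_gt0_pi ypi.
  rewrite addrK /nlog gt_eqF// gtr0_norm// /h -EFinM -!EFinD gE /cst.
  congr EFin; ring.
rewrite integralD//; [|by apply: integrableD => //; exact: ih|exact: ih].
rewrite integralD//; [|exact: ih|exact: ih].
rewrite (Ih _ _ _ i0 E0) (Ih _ _ _ i1 E1) (Ih _ _ _ i2 E2) -!EFinD.
by congr EFin; ring.
Qed.

Let cs1 a : (cos a ^+ 2 + sin a ^+ 2 = 1)%R. Proof. exact: cos2Dsin2. Qed.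

(** The weight is [(1 - cos (2 y)) / 2], so [a] survives only through [cos (2 a)]; this is the
    source of the anisotropic term of [W1]. *)
Lemma integral_sin_sqr_nlog_sin a : (0 <= a <= pi)%R ->
  \int[leb]_(y in `[0%R, pi[) ((sin y ^+ 2)%:E * nlog (sin (y - a))) =
  (2^-1 * lnsin_const - pi / 4 * (cos a ^+ 2 - sin a ^+ 2))%:E.
Proof.
move=> api.
rewrite (@integral_periodic_nlog_sin _ _ _ (cos a ^+ 2 - sin a ^+ 2) (2 * sin a * cos a)
  _ _ api _ _ _ _ integral_cos2_lnsin integral_sin2_lnsin).
- by congr EFin; field.
- move=> y; apply: (@continuous_comp _ _ _ (@sin R) (fun x => (x ^+ 2)%R)).
    exact: continuous_sin.
  exact: exprn_continuous.
- by move=> y; rewrite sqr_ge0.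
- by move=> y; rewrite sinDpi sqrrN.
- move=> y; rewrite sinD.
  have := cs1 a; have := cs1 y.
  move: (sin a) (cos a) (sin y) (cos y) => S C s c h H.
  (* Replacing 1 by the product of the two sums of squares makes both sides homogeneous, and the
     identity becomes purely algebraic. *)
  rewrite [X in (_ = X - _ + _)%R](_ : _ =
    2^-1 * ((c ^+ 2 + s ^+ 2) * (C ^+ 2 + S ^+ 2)))%R; last by rewrite h H !mulr1.
  by field.
Qed.

(** The weight is [sin (2 y) ^+ 2], that is [(1 - cos (4 y)) / 2], the semicircle density in the
    angular variable. The result depends on [a] through [cos (4 a)], which is quadratic in
    [cos (2 a)]. *)
Lemma integral_sin2_sqr_nlog_sin a : (0 <= a <= pi)%R ->
  \int[leb]_(y in `[0%R, pi[) (((2 * sin y * cos y) ^+ 2)%:E * nlog (sin (y - a))) =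
  (2^-1 * lnsin_const - pi / 8 * (8 * cos a ^+ 4 - 8 * cos a ^+ 2 + 1))%:E.
Proof.
move=> api.
rewrite (@integral_periodic_nlog_sin (fun y => ((2 * sin y * cos y) ^+ 2)%R) _ _
  (8 * cos a ^+ 4 - 8 * cos a ^+ 2 + 1) (4 * sin a * cos a * (cos a ^+ 2 - sin a ^+ 2))
  _ _ api _ _ _ _ integral_cos4_lnsin integral_sin4_lnsin).
- by congr EFin; field.
- move=> y; apply: (@continuous_comp _ _ _ (fun y => 2 * sin y * cos y)%R (fun x => (x ^+ 2)%R)).
    apply: cvgM; last exact: continuous_cos.
    by apply: cvgM; [exact: cvg_cst|exact: continuous_sin].
  exact: exprn_continuous.
- by move=> y; rewrite sqr_ge0.
- by move=> y; rewrite sinDpi cosDpi; ring.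
- move=> y; rewrite sinD cosD.
  have := sin2cos2 a; have := sin2cos2 y.
  move: (sin a) (cos a) (sin y) (cos y) => S C s c h H.
  have -> : (2 * (s * C + c * S) * (c * C - s * S) =
      (2 * s * c) * (C ^+ 2 - S ^+ 2) + (c ^+ 2 - s ^+ 2) * (2 * S * C))%R by ring.
  rewrite [X in (_ = X - _ + _)%R](_ : _ = 2^-1 *
    ((c ^+ 2 + s ^+ 2) ^+ 2 * (C ^+ 2 + S ^+ 2) ^+ 2))%R; last first.
    by rewrite h H [(c ^+ 2 + _)%R]addrC [(C ^+ 2 + _)%R]addrC !subrK !expr1n !mulr1.
  have e4 (u v : R) : (v ^+ 2 = 1 - u ^+ 2 ->
      8 * u ^+ 4 - 8 * u ^+ 2 + 1 =
      (u ^+ 2 - v ^+ 2) ^+ 2 - (2 * v * u) ^+ 2)%R.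
    by move=> vu; rewrite exprMn exprMn vu; ring.
  by rewrite (e4 _ _ h) (e4 _ _ H); field.
Qed.

End nlog.

(** * The semicircle law *)

Section density.
Context d (T : measurableType d) (R : realType).
Variables (mu nu : {measure set T -> \bar R}) (g : T -> R).
Hypotheses (mg : measurable_fun setT g) (g0 : forall x, 0 <= g x).
Hypothesis nuE : forall A, measurable A -> nu A = (\int[mu]_(x in A) (g x)%:E)%E.
Local Open Scope ereal_scope.

Let integral_density_indic E : measurable E ->
  \int[nu]_x (\1_E x)%:E = \int[mu]_x ((\1_E x)%:E * (g x)%:E).
Proof.
move=> mE; rewrite integral_indic// setIT nuE// integral_mkcond.
apply: eq_integral => x _; rewrite patchE indicE.
by case: ifPn => xE; rewrite ?(negbTE xE) ?mul0e ?mul1e.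
Qed.

Import HBNNSimple.

Let integral_density_nnsfun (f : {nnsfun T >-> R}) :
  \int[nu]_x (f x)%:E = \int[mu]_x ((f x)%:E * (g x)%:E).
Proof.
under [LHS]eq_integral do rewrite fimfunE -fsumEFin//.
rewrite [LHS]ge0_integral_fsum//; last 2 first.
  - by move=> r; exact/measurable_EFinP/measurableT_comp.
  - by move=> n x _; rewrite EFinM nnfun_muleindic_ge0.
under [RHS]eq_integral.
  move=> x _; rewrite fimfunE -fsumEFin// ge0_mule_fsuml; last first.
    by move=> r; rewrite EFinM nnfun_muleindic_ge0.
  over.
rewrite [RHS]ge0_integral_fsum//; last 2 first.
  - move=> r; apply: emeasurable_funM; last exact/measurable_EFinP.
    by apply/measurable_EFinP; exact: measurableT_comp.
  - by move=> n x _; rewrite mule_ge0 ?lee_fin// -lee_fin EFinM nnfun_muleindic_ge0.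
apply: eq_fsbigr => r; rewrite inE => -[t _ tr].
have r0 : (0 <= r)%R by rewrite -tr.
under eq_integral do rewrite EFinM.
under [RHS]eq_integral do rewrite EFinM -muleA.
have mi : measurable_fun setT (EFin \o \1_(f @^-1` [set r]) : T -> \bar R).
  exact/measurable_EFinP/measurable_indic.
rewrite !ge0_integralZl_EFin//.
- by rewrite integral_density_indic.
- by move=> x _; rewrite mule_ge0// lee_fin.
- by apply: emeasurable_funM => //; exact/measurable_EFinP.
Qed.

(** The usual ascent: indicators, simple functions, then monotone limits on both sides. *)
Lemma ge0_integral_density (f : T -> \bar R) :
  measurable_fun setT f -> (forall x, 0 <= f x) ->
  \int[nu]_x f x = \int[mu]_x (f x * (g x)%:E).
Proof.
move=> mf f0; pose f_ := nnsfun_approx measurableT mf.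
have nd x : {homo (fun n => (f_ n x)%:E) : n m / (n <= m)%N >-> n <= m}.
  by move=> m n mn; rewrite lee_fin; exact/lefP/nd_nnsfun_approx.
have cf x : (f_ n x)%:E @[n --> \oo] --> f x.
  by apply: cvg_nnsfun_approx => // *; apply: f0; rewrite inE.
transitivity (lim (\int[nu]_x (f_ n x)%:E @[n --> \oo])).
  rewrite -monotone_convergence//=.
  - by apply: eq_integral => x _; exact/esym/cvg_lim.
  - by move=> n; exact/measurable_EFinP/measurable_funTS.
  - by move=> n ? _; rewrite lee_fin.
under eq_fun do rewrite integral_density_nnsfun.
rewrite -monotone_convergence//=.
- apply: eq_integral => x _; apply/cvg_lim => //.
  by apply: cvgeZr.
- move=> n; by apply: emeasurable_funM; apply/measurable_EFinP.
- by move=> n x _; rewrite mule_ge0 ?lee_fin.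
- by move=> x _ m n mn; rewrite lee_wpmul2r ?lee_fin//; exact: nd.
Qed.

End density.

(** * Angular parametrisation of the semicircle law *)

Section semicircle_angle.
Context {R : realType}.
Local Notation leb := (@lebesgue_measure R).
Local Notation s2 := (Num.sqrt 2 : R).
Local Notation sc := (@semicircle R).
Implicit Types (x y a p : R).
Local Open Scope ereal_scope.

Lemma semicircle_pdf_ge0 x : (0 <= semicircle_pdf x :> R)%R.
Proof. by rewrite mulr_ge0 ?sqrtr_ge0// invr_ge0 pi_ge0. Qed.

Lemma semicircle_pdf_out x : x \notin `](- s2)%R, s2[ -> semicircle_pdf x = 0%R.
Proof.
move=> xs; rewrite /semicircle_pdf ler0_sqrtr ?mulr0// subr_le0.
rewrite -[leLHS](@sqr_sqrtr R)// -[leRHS]real_normK ?num_real//.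
rewrite lerXn2r ?nnegrE ?sqrtr_ge0//.
move: xs; rewrite in_itv/= -ltr_norml -leNgt; exact.
Qed.

Lemma semicircleE (A : set R) : sc A = \int[leb]_(x in A) (semicircle_pdf x)%:E.
Proof.
rewrite /semicircle integral_mkcondr; apply: eq_integral => x _.
rewrite patchE; case: ifPn => // /negP xs.
by rewrite semicircle_pdf_out//; apply/negP => xI; apply: xs; rewrite inE.
Qed.

(* [R] and [measurableTypeR R] carry the same sigma-algebra under different
   displays. *)
Let lebR : set R -> \bar R := leb.

Let lebR0 : lebR set0 = 0. Proof. exact: (measure0 leb). Qed.

Let lebR_ge0 A : 0 <= lebR A. Proof. exact: (measure_ge0 leb). Qed.

Let lebR_sigma_additive : semi_sigma_additive lebR.
Proof. exact: (@measure_semi_sigma_additive _ _ _ leb). Qed.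

HB.instance Definition _ := isMeasure.Build _ _ _ lebR
  lebR0 lebR_ge0 lebR_sigma_additive.

Let id_measurableTypeR : measurableTypeR R -> R := idfun.

Let ge0_integral_lebR (D : set R) (f : R -> \bar R) : measurable D ->
  measurable_fun D f -> (forall x, D x -> 0 <= f x) ->
  \int[lebR]_(x in D) f x = \int[leb]_(x in D) f x.
Proof.
move=> mD mf f0; have mid : measurable_fun setT id_measurableTypeR by exact: measurable_id.
rewrite [RHS](_ : _ = \int[leb]_(x in id_measurableTypeR @^-1` D)
  (f \o id_measurableTypeR) x)//.
rewrite -(@ge0_integral_pushforward _ _ _ _ R _ mid leb D f)//.
by move=> x; rewrite inE; exact: f0.
Qed.

Lemma ge0_integral_semicircle (f : R -> \bar R) : measurable_fun setT f ->
  (forall x, 0 <= f x) ->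
  \int[sc]_x f x = \int[leb]_(x in `[(- s2)%R, s2]) (f x * (semicircle_pdf x)%:E).
Proof.
move=> mf f0.
have mpdf : measurable_fun [set: R] (@semicircle_pdf R).
  by apply: continuous_measurable_fun; exact: continuous_semicircle_pdf.
rewrite (@ge0_integral_density _ _ R lebR sc semicircle_pdf)//; last 2 first.
- exact: semicircle_pdf_ge0.
- move=> A mA; apply: (etrans (semicircleE A)).
  rewrite ge0_integral_lebR//.
    by apply/measurable_EFinP/measurable_funTS.
  by move=> x _; rewrite lee_fin semicircle_pdf_ge0.
rewrite ge0_integral_lebR//; last 2 first.
- by apply: emeasurable_funM => //; exact/measurable_EFinP.
- by move=> x _; rewrite mule_ge0// lee_fin semicircle_pdf_ge0.
rewrite [RHS]integral_mkcond; apply: eq_integral => x _.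
rewrite patchE; case: ifPn => // /negP xs.
rewrite semicircle_pdf_out ?mule0//; apply/negP => xI; apply: xs.
by rewrite inE; exact: subset_itv_oo_cc xI.
Qed.

(** This is [sqrt 2 * cos (2 y)]. With the double angle, a difference of two values factors into
    sines of [y - a] and [y + a], without half angles. *)
Definition semicircle_angle y : R := (s2 * (cos y ^+ 2 - sin y ^+ 2))%R.
Local Notation F := semicircle_angle.

Definition semicircle_angle_pdf y : R := ((2 * sin y * cos y) ^+ 2)%R.
Local Notation w := semicircle_angle_pdf.

Lemma is_derive_semicircle_angle y :
  is_derive y 1%R F (- (4 * s2 * (sin y * cos y)))%R.
Proof.
apply: is_derive_eq; rewrite /GRing.scale/=.
by move: (sin y) (cos y) => s c; ring.
Qed.

Lemma semicircle_angleE y : F y = (s2 * (2 * cos y ^+ 2 - 1))%R.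
Proof. by rewrite /F sin2cos2; congr (_ * _)%R; ring. Qed.

Lemma continuous_semicircle_angle : continuous F.
Proof.
by move=> y; apply/differentiable_continuous/derivable1_diffP; case: (is_derive_semicircle_angle y).
Qed.

Let cos2_angle y : (2 - F y ^+ 2 = 2 * (2 * sin y * cos y) ^+ 2)%R.
Proof.
rewrite /F exprMn sqr_sqrtr//; have := cos2Dsin2 y.
move: (sin y) (cos y) => s c h.
transitivity (2 * (c ^+ 2 + s ^+ 2) ^+ 2 - 2 * (c ^+ 2 - s ^+ 2) ^+ 2)%R.
  by rewrite h expr1n mulr1.
by ring.
Qed.

(** The second factor on the left is the absolute value of the derivative of [F]: the identity gives
    the density of the pulled-back law. *)
Lemma semicircle_pdf_angle y :
  (semicircle_pdf (F y) * (4 * s2 * `|sin y * cos y|) = 4 / pi * w y)%R.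
Proof.
rewrite /semicircle_pdf cos2_angle sqrtrM// sqrtr_sqr.
have h : (s2 * s2 = 2)%R by rewrite -expr2 sqr_sqrtr.
rewrite /w -[((2 * sin y * cos y) ^+ 2)%R]real_normK ?num_real//.
rewrite !normrM (ger0_norm (_ : 0 <= 2 :> R)%R)//.
move: (`|sin y|%R) (`|cos y|%R) => u v.
transitivity (pi^-1 * (s2 * s2) * (8 * (u * v) ^+ 2))%R; first by ring.
by rewrite h; ring.
Qed.

End semicircle_angle.

(** * Change of variables from the support to the angle *)

Section semicircle_substitution.
Context {R : realType}.
Local Notation leb := (@lebesgue_measure R).
Local Notation s2 := (Num.sqrt 2 : R).
Local Notation sc := (@semicircle R).
Local Notation F := (@semicircle_angle R).
Local Notation w := (@semicircle_angle_pdf R).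
Implicit Types (x y a p : R) (f : R -> R).
Local Open Scope ereal_scope.

Let s20 : (0 < s2)%R. Proof. by rewrite sqrtr_gt0. Qed.

Let dF y : (derive1 F y = - (4 * s2 * (sin y * cos y)))%R.
Proof. by rewrite derive1E; apply: derive_val; exact: is_derive_semicircle_angle. Qed.

Let continuous_dF : continuous (derive1 F).
Proof.
rewrite (_ : (derive1 F) = fun y => (- (4 * s2 * (sin y * cos y)))%R); last exact/funext/dF.
move=> y; apply: cvgN; apply: cvgM; first exact: cvg_cst.
by apply: cvgM; [exact: continuous_sin|exact: continuous_cos].
Qed.

Let derivable_F a b : derivable_oo_LRcontinuous F a b.
Proof.
split.
- by move=> y _; case: (is_derive_semicircle_angle y).
- exact/cvg_at_right_filter/continuous_semicircle_angle.
- exact/cvg_at_left_filter/continuous_semicircle_angle.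
Qed.

Let cvg_dF_right a : cvg (derive1 F y @[y --> a^'+]).
Proof. by apply/cvg_ex; eexists; exact/cvg_at_right_filter/continuous_dF. Qed.

Let cvg_dF_left a : cvg (derive1 F y @[y --> a^'-]).
Proof. by apply/cvg_ex; eexists; exact/cvg_at_left_filter/continuous_dF. Qed.

Let pi0 : (0 < pi :> R)%R. Proof. exact: pi_gt0. Qed.

Let pihalf : (0 <= (pi : R) / 2 <= pi)%R.
Proof. by have := pi0; move: (pi : R) => q ?; apply/andP; split; lra. Qed.

Let F0 : F 0%R = s2.
Proof. by rewrite semicircle_angleE cos0; ring. Qed.

Let Fpihalf : F (pi / 2)%R = (- s2)%R.
Proof. by rewrite semicircle_angleE cos_pihalf; ring. Qed.

Let Fpi : F pi = s2.
Proof. by rewrite semicircle_angleE cospi; ring. Qed.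

Let F_decreasing : {in `[0%R, (pi / 2)%R] &, {homo F : x y /~ (x < y)%R}}.
Proof.
move=> x y; rewrite !in_itv/= => /andP[x0 xp] /andP[y0 yp] yx.
have c0 (z : R) : (0 <= z)%R -> (z <= pi / 2)%R -> (0 <= cos z)%R.
  by move=> z0 z1; rewrite cos_ge0_pihalf//; apply/andP; split; lra.
have cxy : (cos x < cos y)%R.
  by rewrite ltr_cos// in_itv/=; apply/andP; split; lra.
rewrite !semicircle_angleE ltr_pM2l//.
by have := c0 _ x0 xp; have := c0 _ y0 yp; nra.
Qed.

Let F_increasing : {in `[(pi / 2)%R, pi] &, {homo F : x y / (x < y)%R}}.
Proof.
move=> x y; rewrite !in_itv/= => /andP[x0 xp] /andP[y0 yp] yx.
have c0 (z : R) : (pi / 2 <= z)%R -> (z <= pi)%R -> (cos z <= 0)%R.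
  move=> z0 z1; rewrite -(@cos_pihalf R) leNgt; apply/negP.
  by rewrite ltr_cos ?in_itv/=; last 2 first; try (apply/andP; split; lra); lra.
have cxy : (cos y < cos x)%R.
  by rewrite ltr_cos// in_itv/=; apply/andP; split; lra.
rewrite !semicircle_angleE ltr_pM2l//.
by have := c0 _ x0 xp; have := c0 _ y0 yp; nra.
Qed.

Section continuous.
Variable f : R -> R.
Hypotheses (cf : continuous f) (f0 : forall x, (0 <= f x)%R).

Let G x : R := (f x * semicircle_pdf x)%R.

Let cG : continuous G.
Proof. by move=> x; apply: cvgM; [exact: cf|exact: continuous_semicircle_pdf]. Qed.

Let h y : R := (f (F y) * w y)%R.

Let ch : continuous h.
Proof.
move=> y; apply: cvgM.
  by apply: (@continuous_comp _ _ _ F f); [exact: continuous_semicircle_angle|exact: cf].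
apply: (@continuous_comp _ _ _ (fun y => 2 * sin y * cos y)%R (fun x => x ^+ 2)%R).
  apply: cvgM; last exact: continuous_cos.
  by apply: cvgM; [exact: cvg_cst|exact: continuous_sin].
exact: exprn_continuous.
Qed.

Let h0 y : (0 <= h y)%R.
Proof. by rewrite mulr_ge0// sqr_ge0. Qed.

Let mh (D : set R) : measurable_fun D (EFin \o h).
Proof. by apply/measurable_EFinP/measurable_funTS; exact: continuous_measurable_fun. Qed.

Let half_decreasing : \int[leb]_(x in `[(- s2)%R, s2]) (G x)%:E =
  (4 / pi)%:E * \int[leb]_(y in `[0%R, (pi / 2)%R[) (h y)%:E.
Proof.
rewrite -[X in `[_, X]]F0 -Fpihalf integration_by_substitution_decreasing//.
- rewrite (@integral_itv_bndoo _ 0%R (pi / 2)%R (EFin \o h) true true); last exact: mh.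
  rewrite -ge0_integralZl//; last 3 first.
  + exact: mh.
  + by move=> y _; rewrite lee_fin.
  + by rewrite lee_fin divr_ge0// ltW.
  rewrite integral_itv_bndoo; last first.
    apply/measurable_EFinP/measurable_funTS; apply: continuous_measurable_fun => y.
    apply: cvgM; last by apply: cvgN; exact: continuous_dF.
    by apply: (@continuous_comp _ _ _ F G); [exact: continuous_semicircle_angle|exact: cG].
  apply: eq_integral => y; rewrite inE/= in_itv/= => /andP[y0 yp].
  rewrite -EFinM; congr EFin.
  have sc0 : (0 <= sin y * cos y)%R.
    by rewrite mulr_ge0 ?sin_ge0_pi ?cos_ge0_pihalf//; apply/andP; split; lra.
  rewrite /h mulrCA -semicircle_pdf_angle ger0_norm//.
  rewrite -[LHS]/(f (F y) * semicircle_pdf (F y) * - derive1 F y)%R dF; ring.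
- by case/andP: pihalf.
- by apply: continuous_subspaceT.
Qed.

Let half_increasing : \int[leb]_(x in `[(- s2)%R, s2]) (G x)%:E =
  (4 / pi)%:E * \int[leb]_(y in `[(pi / 2)%R, pi[) (h y)%:E.
Proof.
rewrite -[X in `[_, X]]Fpi -Fpihalf integration_by_substitution_increasing//.
- rewrite (@integral_itv_bndoo _ (pi / 2)%R pi (EFin \o h) true true); last exact: mh.
  rewrite -ge0_integralZl//; last 3 first.
  + exact: mh.
  + by move=> y _; rewrite lee_fin.
  + by rewrite lee_fin divr_ge0// ltW.
  rewrite integral_itv_bndoo; last first.
    apply/measurable_EFinP/measurable_funTS; apply: continuous_measurable_fun => y.
    apply: cvgM; last exact: continuous_dF.
    by apply: (@continuous_comp _ _ _ F G); [exact: continuous_semicircle_angle|exact: cG].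
  apply: eq_integral => y; rewrite inE/= in_itv/= => /andP[y0 yp].
  rewrite -EFinM; congr EFin.
  have sc0 : (sin y * cos y <= 0)%R.
    rewrite mulr_ge0_le0 ?sin_ge0_pi//; first by apply/andP; split; lra.
    rewrite -(@cos_pihalf R) leNgt; apply/negP.
    by rewrite ltr_cos ?in_itv/=; last 2 first; try (apply/andP; split; lra); lra.
  rewrite /h mulrCA -semicircle_pdf_angle ler0_norm//.
  rewrite -[LHS]/(f (F y) * semicircle_pdf (F y) * derive1 F y)%R dF; ring.
- by case/andP: pihalf.
- by apply: continuous_subspaceT.
Qed.

(* [y |-> sqrt 2 * cos (2 y)] covers the support twice on [0, pi]. *)
Lemma integral_semicircle_angle_continuous :
  \int[sc]_x (f x)%:E = (2 / pi)%:E * \int[leb]_(y in `[0%R, pi[) (f (F y) * w y)%:E.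
Proof.
rewrite ge0_integral_semicircle//; last first.
  by apply/measurable_EFinP; exact: continuous_measurable_fun.
rewrite (@ge0_integral_itvco_split _ _ _ (pi / 2)%R)//; last 2 first.
- by case/andP: pihalf.
- by case/andP: pihalf.
have h2 : (2 / pi = 2^-1 * (4 / pi) :> R)%R by rewrite mulrA; congr (_ / _)%R; field.
rewrite h2 EFinM -muleA ge0_muleDr; last 2 first.
- by apply: integral_ge0 => y _; rewrite lee_fin h0.
- by apply: integral_ge0 => y _; rewrite lee_fin h0.
rewrite -half_decreasing -half_increasing -mule2n.
by rewrite -[X in _ * X]mule_natl muleA -EFinM mulVf// mul1e.
Qed.

End continuous.

End semicircle_substitution.

(** * The one-dimensional log-gas kernel *)

Section log_gas_kernel.
Context {R : realType}.
Local Notation leb := (@lebesgue_measure R).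
Local Notation sc := (@semicircle R).
Local Notation F := (@semicircle_angle R).
Local Notation w := (@semicircle_angle_pdf R).
Implicit Types (x y a p q : R).
Local Open Scope ereal_scope.

(** Confinement is built into the kernel to make it nonnegative, so that integrals can be exchanged
    and added freely. *)
Definition k1 p q : \bar R := nlog (p - q) + (2^-1 * (p ^+ 2 + q ^+ 2))%:E.

(** Bounding the distance below by [1 / (n + 1)] gives continuous kernels increasing to [k1]; the
    change of variables is available for continuous integrands and passes to [k1] by monotone
    convergence. *)
Definition k1_trunc n p q : R :=
  (- ln (Num.max `|p - q| n.+1%:R^-1) + 2^-1 * (p ^+ 2 + q ^+ 2))%R.

(** With [t = |p - q|], the kernel is at least [1 - t + t^2 / 4], and [(t / 2 - 2)^2 >= 0]. Linear
    growth is what absorbs the error of the Gram approximation in [E_le_interaction]. *)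
Lemma k1_ge p q : (`|p - q| - 3)%:E <= k1 p q.
Proof.
apply: (@le_trans _ _ ((1 - `|p - q|)%:E + (2^-1 * (p ^+ 2 + q ^+ 2))%:E)).
  rewrite -EFinD lee_fin.
  have : ((p - q) ^+ 2 = `|p - q| ^+ 2)%R by rewrite real_normK ?num_real.
  move: (`|p - q|)%R => t h.
  have : (0 <= (t / 2 - 2) ^+ 2)%R by exact: sqr_ge0.
  have : (0 <= (p + q) ^+ 2)%R by exact: sqr_ge0.
  by move: h; rewrite !expr2; lra.
by rewrite leeD2r// nlog_ge.
Qed.

(** The lower bound [1 - t + t^2 / 4] is the square of [t / 2 - 1]. *)
Lemma k1_ge0 p q : 0 <= k1 p q.
Proof.
apply: (@le_trans _ _ ((1 - `|p - q|)%:E + (2^-1 * (p ^+ 2 + q ^+ 2))%:E)).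
  rewrite -EFinD lee_fin.
  have : ((p - q) ^+ 2 = `|p - q| ^+ 2)%R by rewrite real_normK ?num_real.
  move: (`|p - q|)%R => t h.
  have : (0 <= (t / 2 - 1) ^+ 2)%R by exact: sqr_ge0.
  have : (0 <= (p + q) ^+ 2)%R by exact: sqr_ge0.
  by move: h; rewrite !expr2; lra.
by rewrite leeD2r// nlog_ge.
Qed.

Lemma k1N p q : k1 (- p) (- q) = k1 p q.
Proof. by rewrite /k1 -opprD nlogN !sqrrN. Qed.

Lemma measurable_k1 : measurable_fun [set: R * R] (fun z => k1 z.1 z.2).
Proof.
apply: emeasurable_funD.
  by apply: measurableT_comp; [exact: measurable_nlog|exact: measurable_funB].
apply/measurable_EFinP/measurable_funM => //.
by apply: measurable_funD; exact: measurable_funX.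
Qed.

Lemma measurable_k1l p : measurable_fun [set: R] (k1 p).
Proof. exact: (measurableT_comp measurable_k1 (pair1_measurable p)). Qed.

Lemma k1_trunc_ge0 n p q : (0 <= k1_trunc n p q)%R.
Proof.
rewrite /k1_trunc; case: (leP `|p - q|%R (n.+1%:R^-1)%R) => h.
  rewrite addr_ge0//; last by rewrite mulr_ge0// addr_ge0// sqr_ge0.
  by rewrite oppr_ge0 ln_le0// invf_le1// ler1n.
have pq0 : (0 < `|p - q|)%R by rewrite (le_lt_trans _ h)// invr_ge0.
by have := k1_ge0 p q; rewrite /k1 /nlog -normr_eq0 gt_eqF// -EFinD lee_fin.
Qed.

Lemma nondecreasing_k1_trunc p q :
  {homo (fun n => k1_trunc n p q) : m n / (m <= n)%N >-> (m <= n)%R}.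
Proof.
move=> m n mn; rewrite lerD2r lerN2 ler_ln ?posrE//.
by rewrite ge_max !le_max lexx/= lef_pV2 ?posrE// ler_nat ltnS mn orbT.
Qed.

Lemma cvg_k1_trunc p q : (k1_trunc n p q)%:E @[n --> \oo] --> k1 p q.
Proof.
have [<-|pq] := eqVneq p q.
  rewrite /k1 subrr /nlog eqxx addye//.
  apply/cvgeyPge => A; near=> n; rewrite lee_fin /k1_trunc subrr normr0.
  rewrite max_r ?invr_ge0// lnV ?posrE// opprK.
  apply: (@le_trans _ _ (ln (expR A))); first by rewrite expRK.
  apply: (@le_trans _ _ (ln n.+1%:R)).
    rewrite ler_ln ?posrE ?expR_gt0//.
    by rewrite (@le_trans _ _ n%:R%R) ?ler_nat//; near: n; exact: nbhs_infty_ger.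
  by rewrite lerDl mulr_ge0// addr_ge0// sqr_ge0.
apply: cvg_near_cst; near=> n.
have pq0 : (0 < `|p - q|)%R by rewrite normr_gt0 subr_eq0.
rewrite /k1 /nlog subr_eq0 (negbTE pq) -EFinD /k1_trunc max_l//.
rewrite invf_ple ?posrE//.
by rewrite (@le_trans _ _ n%:R%R) ?ler_nat//; near: n; exact: nbhs_infty_ger.
Unshelve. all: end_near. Qed.

Lemma continuous_k1_trunc n p : continuous (k1_trunc n p).
Proof.
move=> q; apply: cvgD.
  apply: cvgN.
  apply: (@continuous_comp _ _ _ (fun q => Num.max `|p - q| n.+1%:R^-1)%R (@ln R)).
    apply: continuous_max; last exact: cvg_cst.
    apply: (@continuous_comp _ _ _ (fun q => p - q)%R (fun x => `|x|)%R).
      by apply: cvgB; [exact: cvg_cst|exact: cvg_id].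
    exact: norm_continuous.
  exact: continuous_ln.
apply: cvgM; first exact: cvg_cst.
by apply: cvgD; [exact: cvg_cst|exact: exprn_continuous].
Qed.

Lemma integral_semicircle_k1 p :
  \int[sc]_q k1 p q = (2 / pi)%:E * \int[leb]_(y in `[0%R, pi[) (k1 p (F y) * (w y)%:E).
Proof.
have w0 y : (0 <= w y)%R by exact: sqr_ge0.
have mF : measurable_fun setT F.
  by apply: continuous_measurable_fun; exact: continuous_semicircle_angle.
have mw : measurable_fun setT w.
  apply: measurable_funX; apply: measurable_funM.
    by apply: measurable_funM => //; apply: continuous_measurable_fun; exact: continuous_sin.
  by apply: continuous_measurable_fun; exact: continuous_cos.
have mk n : measurable_fun setT (k1_trunc n p).
  by apply: continuous_measurable_fun; exact: continuous_k1_trunc.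
transitivity (lim (\int[sc]_q (k1_trunc n p q)%:E @[n --> \oo])).
  rewrite -monotone_convergence//.
  - by apply: eq_integral => q _; apply/esym/cvg_lim => //; exact: cvg_k1_trunc.
  - by move=> n; exact/measurable_EFinP.
  - by move=> n q _; rewrite lee_fin k1_trunc_ge0.
  - by move=> q _ m n mn; rewrite lee_fin nondecreasing_k1_trunc.
under eq_fun do rewrite (integral_semicircle_angle_continuous
  (@continuous_k1_trunc _ p) (@k1_trunc_ge0 _ p)).
have mkF n : measurable_fun `[0%R, pi[ (fun y => (k1_trunc n p (F y) * w y)%:E).
  apply/measurable_EFinP/measurable_funTS/measurable_funM => //.
  exact: measurableT_comp.
have nd y : {homo (fun n => (k1_trunc n p (F y) * w y)%:E) :
    m n / (m <= n)%N >-> m <= n}.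
  by move=> m n mn; rewrite lee_fin ler_wpM2r// nondecreasing_k1_trunc.
rewrite limeMl//; last first.
  apply: ereal_nondecreasing_is_cvgn => m n mn; apply: ge0_le_integral => //.
  - by move=> y _; rewrite lee_fin mulr_ge0// k1_trunc_ge0.
  - exact: mkF.
  - exact: mkF.
  - by move=> y _; exact: nd.
congr (_ * _); rewrite -monotone_convergence//.
- apply: eq_integral => y _; apply/cvg_lim => //.
  under eq_fun do rewrite EFinM.
  by apply: cvgeZr => //; exact: cvg_k1_trunc.
- by move=> n y _; rewrite lee_fin mulr_ge0// k1_trunc_ge0.
Qed.

End log_gas_kernel.

(** * The potential of the semicircle law *)

Section semicircle_potential.
Context {R : realType}.
Local Notation leb := (@lebesgue_measure R).
Local Notation s2 := (Num.sqrt 2 : R).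
Local Notation sc := (@semicircle R).
Local Notation F := (@semicircle_angle R).
Local Notation w := (@semicircle_angle_pdf R).
Implicit Types (x y a p q : R).
Local Open Scope ereal_scope.

Let s20 : (0 < s2)%R. Proof. by rewrite sqrtr_gt0. Qed.

Let s2s2 : (s2 * s2 = 2)%R. Proof. by rewrite -expr2 sqr_sqrtr. Qed.

Let w0 y : (0 <= w y)%R. Proof. exact: sqr_ge0. Qed.

Let mF : measurable_fun setT F.
Proof. by apply: continuous_measurable_fun; exact: continuous_semicircle_angle. Qed.

Let cw : continuous w.
Proof.
move=> y; apply: (@continuous_comp _ _ _ (fun y => 2 * sin y * cos y)%R (fun x => x ^+ 2)%R).
  apply: cvgM; last exact: continuous_cos.
  by apply: cvgM; [exact: cvg_cst|exact: continuous_sin].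
exact: exprn_continuous.
Qed.

Let mw : measurable_fun setT w.
Proof. exact: continuous_measurable_fun cw. Qed.

Let F2 y : (F y ^+ 2 = 2 - 2 * w y)%R.
Proof.
rewrite /F /w exprMn sqr_sqrtr//; have := cos2Dsin2 y.
rewrite /semicircle_angle_pdf.
move: (sin y) (cos y) => s c h.
transitivity (2 * (c ^+ 2 + s ^+ 2) ^+ 2 - 2 * (2 * s * c) ^+ 2)%R; first by ring.
by rewrite h expr1n mulr1.
Qed.

Let integral_ftc (f P : R -> R) : continuous f -> (forall y, 0 <= f y)%R ->
  (forall y, is_derive y 1%R P (f y)) ->
  \int[leb]_(y in `[0%R, pi[) (f y)%:E = (P pi - P 0)%:E.
Proof.
move=> cf f0 dP; rewrite integral_itv_bndoo; last first.
  by apply/measurable_EFinP/measurable_funTS; exact: continuous_measurable_fun.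
apply: ge0_integral_itvoo => //; first exact: pi_gt0.
by move=> y; apply/differentiable_continuous/derivable1_diffP; case: (dP y).
Qed.

Let integral_w : \int[leb]_(y in `[0%R, pi[) (w y)%:E = (pi / 2)%:E.
Proof.
have dP y : is_derive y 1%R
    (fun y => 2^-1 * (y - sin y * cos y * (cos y ^+ 2 - sin y ^+ 2)))%R (w y).
  apply: is_derive_eq; rewrite /GRing.scale/= /semicircle_angle_pdf.
  have := cos2Dsin2 y; move: (sin y) (cos y) => s c h.
  transitivity (2^-1 * ((c ^+ 2 + s ^+ 2) ^+ 2 + 4 * s ^+ 2 * c ^+ 2 -
    (c ^+ 2 - s ^+ 2) ^+ 2))%R; last by field.
  by rewrite h expr1n; ring.
by rewrite (integral_ftc cw w0 dP) sinpi sin0; congr EFin; ring.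
Qed.

Let integral_cos2 : \int[leb]_(y in `[0%R, pi[) (cos y ^+ 2)%:E = (pi / 2)%:E.
Proof.
have dP y : is_derive y 1%R (fun y => 2^-1 * (y + sin y * cos y))%R (cos y ^+ 2)%R.
  apply: is_derive_eq; rewrite /GRing.scale/=.
  by have := cos2sin2 y; move: (sin y) (cos y) => s c; lra.
have cc : continuous (fun y : R => cos y ^+ 2)%R.
  move=> y; apply: (@continuous_comp _ _ _ (@cos R) (fun x => x ^+ 2)%R).
    exact: continuous_cos.
  exact: exprn_continuous.
rewrite (integral_ftc cc _ dP) ?sinpi ?sin0; last by move=> y; exact: sqr_ge0.
by congr EFin; ring.
Qed.

Let m2 : R := fine (\int[leb]_(y in `[0%R, pi[) (F y ^+ 2 * w y)%:E).

Let mF2w : measurable_fun `[0%R, pi[ (fun y => (F y ^+ 2 * w y)%:E).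
Proof.
apply/measurable_EFinP/measurable_funTS/measurable_funM => //.
exact: measurable_funX.
Qed.

Let integral_F2w : \int[leb]_(y in `[0%R, pi[) (F y ^+ 2 * w y)%:E = m2%:E.
Proof.
rewrite /m2 fineK// ge0_fin_numE; last first.
  by apply: integral_ge0 => y _; rewrite lee_fin mulr_ge0// sqr_ge0.
apply: (@le_lt_trans _ _ (\int[leb]_(y in `[0%R, pi[) (2%:E * (w y)%:E))).
  apply: ge0_le_integral => //.
  - by move=> y _; rewrite lee_fin mulr_ge0// sqr_ge0.
  - apply: emeasurable_funM => //; apply/measurable_EFinP; exact: measurable_funTS.
  - move=> y _; rewrite -EFinM lee_fin ler_wpM2r// F2.
    by have := w0 y; lra.
rewrite ge0_integralZl//.
- by rewrite integral_w ltry.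
- by apply/measurable_EFinP; exact: measurable_funTS.
- by move=> y _; rewrite lee_fin.
Qed.

Let U p := \int[leb]_(y in `[0%R, pi[) (k1 p (F y) * (w y)%:E).

Let mU p : measurable_fun [set: R] (fun y => k1 p (F y) * (w y)%:E).
Proof.
apply: emeasurable_funM; last exact/measurable_EFinP.
by apply: measurableT_comp mF; exact: measurable_k1l.
Qed.

Let integrand_ge0 p y : 0 <= k1 p (F y) * (w y)%:E.
Proof. by rewrite mule_ge0 ?k1_ge0 ?lee_fin. Qed.

Let c22 : R := ln (2 * s2).

Let s2ge1 : (1 <= s2)%R.
Proof.
rewrite leNgt; apply/negP => h; have := s2s2; have := s20; move: h.
by move: s2 => t h t0 tt; nra.
Qed.

Let c22_ge0 : (0 <= c22)%R.
Proof. by rewrite ln_ge0//; have := s2ge1; lra. Qed.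

Let U0 : R := lnsin_const + pi / 4 + 2^-1 * m2 - c22 * (pi / 2).

(** [cos (2 a) - cos (2 y)] is [2 * sin (y - a) * sin (y + a)]. Writing [y + a] as
    [y - (pi - a) + pi] puts both shifts in [[0, pi]], where the log-sine integral applies. The
    constant stays on the left so that every term is nonnegative. *)
Let nlog_F a y : nlog (F a - F y)%R + c22%:E =
  nlog (sin (y - a)) + nlog (sin (y - (pi - a))).
Proof.
have -> : (F a - F y = - (2 * s2 * (sin (y - a) * sin (y - (pi - a)))))%R.
  have -> : (y - (pi - a) = y + a - pi)%R by ring.
  rewrite (sinB (y + a)%R) sinpi cospi mulr0 subr0 mulrN1 sinB sinD !semicircle_angleE.
  have := sin2cos2 a; have := sin2cos2 y.
  move: s2 (sin a) (cos a) (sin y) (cos y) => t S C s c hs Hs; apply/esym.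
  transitivity (2 * t * (s ^+ 2 * C ^+ 2 - c ^+ 2 * S ^+ 2))%R; first by ring.
  by rewrite hs Hs; ring.
rewrite nlogN !nlogM addeAC -[RHS]add0e; congr (_ + _).
rewrite -nlogM /nlog gt_eqF ?mulr_gt0// gtr0_norm ?mulr_gt0//.
by rewrite -EFinD addNr.
Qed.

(** The two log-sine integrals together contribute [- pi / 4 * cos (4 a)], which is
    [- pi / 4 * (F a ^+ 2 - 1)]; the confinement contributes [pi / 4 * F a ^+ 2], and the dependence
    on [a] cancels. *)
Let U_segment a : (0 <= a <= pi)%R -> U (F a) = U0%:E.
Proof.
move=> api.
have api' : (0 <= pi - a <= pi)%R by move: api => /andP[? ?]; apply/andP; split; lra.
have ms b : measurable_fun `[0%R, pi[ (fun y => (w y)%:E * nlog (sin (y - b)%R)).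
  apply: measurable_funTS; apply: emeasurable_funM; first exact/measurable_EFinP.
  apply: measurableT_comp; first exact: measurable_nlog.
  apply: measurableT_comp; last exact: measurable_funB.
  by apply: continuous_measurable_fun; exact: continuous_sin.
have s0 b y : 0 <= (w y)%:E * nlog (sin (y - b)%R).
  by rewrite mule_ge0 ?lee_fin// nlog_ge0// sin_max.
have mw' (k : R) : measurable_fun `[0%R, pi[ (fun y => k%:E * (w y)%:E).
  by apply: emeasurable_funM => //; apply/measurable_EFinP; exact: measurable_funTS.
have w0' (k : R) y : (0 <= k)%R -> 0 <= k%:E * (w y)%:E.
  by move=> k0; rewrite mule_ge0// lee_fin.
have Iw (k : R) : (0 <= k)%R -> \int[leb]_(y in `[0%R, pi[) (k%:E * (w y)%:E) = (k * (pi / 2))%:E.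
  move=> k0; rewrite ge0_integralZl//.
  - by rewrite integral_w.
  - by apply/measurable_EFinP; exact: measurable_funTS.
  - by move=> y _; rewrite lee_fin.
have k0 : (0 <= 2^-1 * F a ^+ 2)%R by rewrite mulr_ge0// sqr_ge0.
suff h : U (F a) + (c22 * (pi / 2))%:E = (U0 + c22 * (pi / 2))%:E.
  have fin : (c22 * (pi / 2))%:E \is a fin_num by [].
  by rewrite -(addeK (U (F a)) fin) h -EFinB addrK.
rewrite -Iw// -ge0_integralD//; last 3 first.
- exact: (measurable_funTS (mU _)).
- by move=> y _; exact: w0'.
- exact: mw'.
transitivity (\int[leb]_(y in `[0%R, pi[)
    (((w y)%:E * nlog (sin (y - a)%R) + (w y)%:E * nlog (sin (y - (pi - a))%R)) +
     ((2^-1 * F a ^+ 2)%:E * (w y)%:E + 2^-1%:E * (F y ^+ 2 * w y)%:E))).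
  apply: eq_integral => y _.
  rewrite -ge0_muleDr ?nlog_ge0 ?sin_max// -nlog_F.
  rewrite -!EFinM -EFinD [RHS]addeC.
  rewrite [in RHS](_ : (_ + _)%R = (w y * (2^-1 * (F a ^+ 2 + F y ^+ 2)))%R); last by ring.
  have -> : k1 (F a) (F y) * (w y)%:E + (c22 * w y)%:E =
      (w y)%:E * (k1 (F a) (F y) + c22%:E).
    by rewrite (EFinM c22) -ge0_muleDl ?k1_ge0// muleC.
  rewrite (EFinM (w y)) -muleDr// ?fin_num_adde_defr//.
  by rewrite /k1 addeAC addeC.
rewrite ge0_integralD//; last 4 first.
- by move=> y _; rewrite adde_ge0.
- by apply: emeasurable_funD; exact: ms.
- by move=> y _; rewrite adde_ge0// ?w0'// lee_fin mulr_ge0// mulr_ge0// sqr_ge0.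
- apply: emeasurable_funD; first exact: mw'.
  by apply: emeasurable_funM.
have mh : measurable_fun `[0%R, pi[ (fun y => 2^-1%:E * (F y ^+ 2 * w y)%:E).
  exact: emeasurable_funM.
have h0 y : 0 <= 2^-1%:E * (F y ^+ 2 * w y)%:E.
  by rewrite lee_fin mulr_ge0// mulr_ge0// sqr_ge0.
rewrite !ge0_integralD//; try exact: ms; try exact: mw'; try by move=> y _; exact: w0'.
rewrite Iw// ge0_integralZl//; last first.
  by move=> y _; rewrite lee_fin mulr_ge0// sqr_ge0.
rewrite integral_F2w !integral_sin2_sqr_nlog_sin// -EFinM -!EFinD; congr EFin.
have -> : cos (pi - a) = (- cos a)%R :> R by rewrite cosB cospi sinpi; ring.
by rewrite semicircle_angleE exprMn sqr_sqrtr// /U0; field.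
Qed.

(** Shifting the angle by [pi / 2] negates [F] and preserves [w]. *)
Let UN p : U (- p)%R = U p.
Proof.
have pi20 : (0 <= (pi : R) / 2 <= pi)%R.
  by have := @pi_gt0 R; move: (pi : R) => t t0; apply/andP; split; lra.
rewrite /U -(@ge0_integral_periodic _ _ pi (pi / 2)%R)//.
- apply: eq_integral => y _; rewrite -(k1N p); congr (k1 _ _ * _%:E).
    by rewrite /semicircle_angle cosDpihalf sinDpihalf; ring.
  by rewrite /semicircle_angle_pdf cosDpihalf sinDpihalf; ring.
- move=> y; congr (k1 _ _ * _%:E).
    by rewrite /semicircle_angle cosDpi sinDpi; ring.
  by rewrite /semicircle_angle_pdf cosDpi sinDpi; ring.
Qed.

Let F0 : F 0%R = s2.
Proof. by rewrite semicircle_angleE cos0; ring. Qed.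

(* Outside the support, concavity of [ln] and the bounded ratio
   [w y / (s2 - F y) = s2 * cos y ^+ 2] replace the derivative of the potential. *)
Let U_outside p : (s2 < p)%R -> U0%:E <= U p.
Proof.
move=> p2.
have cc : measurable_fun `[0%R, pi[ (fun y : R => (cos y ^+ 2)%:E).
  apply/measurable_EFinP/measurable_funTS/measurable_funX.
  by apply: continuous_measurable_fun; exact: continuous_cos.
have mw' : measurable_fun `[0%R, pi[ (fun y => (w y)%:E).
  by apply/measurable_EFinP; exact: measurable_funTS.
have d0 : (0 <= (p ^+ 2 - 2) / 2)%R by have := s2s2; have := s20; nra.
have e0 : (0 <= (p - s2) * s2)%R by rewrite mulr_ge0 ?subr_ge0 ?ltW.
have mc (k : R) (f : R -> \bar R) : measurable_fun `[0%R, pi[ f ->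
    measurable_fun `[0%R, pi[ (fun y => k%:E * f y).
  by move=> mf; apply: emeasurable_funM.
(* Relative to the edge [s2], confinement gains [(p^2 - 2) / 2] and the logarithm loses at most
   [(p - s2) * s2], both times [pi / 2]; gain minus loss is [(p - s2)^2 / 2]. *)
suff h : U s2 + ((p ^+ 2 - 2) / 2 * (pi / 2))%:E <=
    U p + ((p - s2) * s2 * (pi / 2))%:E.
  have Us2 : U s2 = U0%:E.
    by rewrite -F0 U_segment// lexx pi_ge0.
  rewrite Us2 in h.
  have fin : ((p - s2) * s2 * (pi / 2))%:E \is a fin_num by [].
  rewrite -(addeK (U p) fin) leeBrDr//; apply: le_trans h.
  rewrite -!EFinD lee_fin lerD2l ler_wpM2r ?divr_ge0 ?pi_ge0//.
  by have := s2s2; have := sqr_ge0 (p - s2); nra.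
have -> : ((p ^+ 2 - 2) / 2 * (pi / 2))%:E =
    \int[leb]_(y in `[0%R, pi[) (((p ^+ 2 - 2) / 2)%:E * (w y)%:E).
  by rewrite ge0_integralZl// ?integral_w// => y _; rewrite lee_fin.
have -> : ((p - s2) * s2 * (pi / 2))%:E =
    \int[leb]_(y in `[0%R, pi[) (((p - s2) * s2)%:E * (cos y ^+ 2)%:E).
  by rewrite ge0_integralZl// ?integral_cos2// => y _; rewrite lee_fin sqr_ge0.
have ge0w y : 0 <= ((p ^+ 2 - 2) / 2)%:E * (w y)%:E by rewrite mule_ge0// lee_fin.
have ge0c y : 0 <= ((p - s2) * s2)%:E * (cos y ^+ 2)%:E.
  by rewrite mule_ge0// lee_fin// sqr_ge0.
rewrite /U -!ge0_integralD//; try exact: (measurable_funTS (mU _)); try exact: mc.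
apply: ge0_le_integral => //.
- by move=> y _; rewrite adde_ge0.
- by apply: emeasurable_funD; [exact: (measurable_funTS (mU _))|exact: mc].
- by apply: emeasurable_funD; [exact: (measurable_funTS (mU _))|exact: mc].
(* Where [sin y = 0], the point [F y] is the edge itself and [k1 s2 (F y)] is infinite, but the
   weight [w y] is 0 and the product is 0. *)
move=> y _; have [sy0|sy0] := eqVneq (sin y) 0%R.
  have -> : w y = 0%R by rewrite /semicircle_angle_pdf sy0; ring.
  by rewrite !mule0 !add0e.
have sFE : (s2 - F y = 2 * s2 * sin y ^+ 2)%R.
  by rewrite semicircle_angleE cos2sin2; ring.
have sF : (0 < s2 - F y)%R 
  by rewrite sFE pmulr_lgt0 ?exprn_even_gt0// mulr_gt0.
have pF : (0 < p - F y)%R by move: sF p2; move: s2 => t; lra.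
rewrite /k1 /nlog !gt_eqF// !gtr0_norm// lee_fin.
have wE : (w y = 2 * s2 * sin y ^+ 2 * (s2 * cos y ^+ 2))%R.
  have -> : (2 * s2 * sin y ^+ 2 * (s2 * cos y ^+ 2) =
    2 * (s2 * s2) * sin y ^+ 2 * cos y ^+ 2)%R by ring.
  by rewrite s2s2 /semicircle_angle_pdf; ring.
have lnle : (ln (p - F y) - ln (s2 - F y) <= (p - s2) / (s2 - F y))%R.
  have -> : ((p - s2) / (s2 - F y) = (p - F y) / (s2 - F y) - 1)%R.
    by rewrite -[X in (_ = _ - X)%R](divff (lt0r_neq0 sF)) -mulrBl; congr (_ / _)%R; ring.
  rewrite -ln_div ?posrE//.
  have := @le_ln1Dx R ((p - F y) / (s2 - F y) - 1).
  by rewrite addrCA subrr addr0; apply; rewrite ltrBrDr addNr divr_gt0.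
have rw : ((p - s2) / (s2 - F y) * w y = (p - s2) * s2 * cos y ^+ 2)%R.
  rewrite wE -sFE; move: sF => /lt0r_neq0; move: (s2 - F y)%R (cos y ^+ 2)%R => t c t0.
  by field.
rewrite -rw -subr_ge0.
have -> : ((- ln (p - F y) + 2^-1 * (p ^+ 2 + F y ^+ 2)) * w y +
    (p - s2) / (s2 - F y) * w y -
    ((- ln (s2 - F y) + 2^-1 * (s2 ^+ 2 + F y ^+ 2)) * w y + (p ^+ 2 - 2) / 2 * w y) =
    w y * ((p - s2) / (s2 - F y) - (ln (p - F y) - ln (s2 - F y))))%R.
  by rewrite (expr2 s2) s2s2; field; exact: lt0r_neq0.
by rewrite mulr_ge0// subr_ge0.
Qed.

Definition potential_min : R := (2 / pi * U0)%R.

Lemma potential_segment p : (- s2 <= p <= s2)%R -> \int[sc]_q k1 p q = potential_min%:E.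
Proof.
move=> /andP[p1 p2]; rewrite integral_semicircle_k1 -/(U p) (EFinM (2 / pi)%R); congr (_ * _).
have ps : (-1 <= p / s2 <= 1)%R.
  by rewrite ler_pdivlMr// ler_pdivrMr// mulN1r mul1r p1 p2.
have -> : p = F (acos (p / s2) / 2).
  rewrite semicircle_angleE.
  have -> : (2 * cos (acos (p / s2) / 2) ^+ 2 - 1 = cos (acos (p / s2)))%R.
    have {2}-> : (acos (p / s2) = (acos (p / s2) / 2) *+ 2)%R by rewrite -mulr_natr; field.
    by rewrite cos_mulr2n; ring.
  by rewrite acosK ?in_itv//=; field; rewrite gt_eqF.
apply: U_segment.
have := acos_ge0 ps; have := acos_lepi ps; have := @pi_gt0 R.
move: (acos _) (pi : R) => u t ? ? ?; apply/andP; split; lra.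
Qed.

Lemma potential_ge p : potential_min%:E <= \int[sc]_q k1 p q.
Proof.
have [/potential_segment -> //|] := boolP ((- s2 <= p) && (p <= s2))%R.
rewrite negb_and -!ltNge integral_semicircle_k1 -/(U p) (EFinM (2 / pi)%R) => h.
rewrite lee_wpmul2l// ?lee_fin ?divr_ge0 ?pi_ge0//.
case/orP : h => h; last exact: U_outside.
by rewrite -UN; apply: U_outside; rewrite ltrNr.
Qed.

End semicircle_potential.

(** * Positivity of the logarithmic kernel *)

(* A kernel of the form [K p q = \int b w p * b w q dmu(w)] is positive
   semidefinite: integrating the square of [mass rho - mass tau] shows it. *)
Section gram_kernel.
Context d (W : measurableType d) d' (T : measurableType d') (R : realType).
Variable mu : {sigma_finite_measure set W -> \bar R}.
Variables (b : W -> T -> R) (M : W -> R).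
Hypotheses (b0 : forall w p, 0 <= b w p) (bM : forall w p, b w p <= M w).
Hypothesis mb : measurable_fun [set: W * T] (fun z => b z.1 z.2).
Implicit Types rho tau : probability T R.
Local Open Scope ereal_scope.

Definition gram_kernel p q := \int[mu]_w (b w p * b w q)%:E.

Definition gram_mass rho w := \int[rho]_p (b w p)%:E.

Lemma gram_kernel_ge0 p q : 0 <= gram_kernel p q.
Proof. by apply: integral_ge0 => w _; rewrite lee_fin mulr_ge0. Qed.

Lemma gram_mass_ge0 rho w : 0 <= gram_mass rho w.
Proof. by apply: integral_ge0 => p _; rewrite lee_fin. Qed.

Let mbw w : measurable_fun setT (b w).
Proof. exact: (measurableT_comp mb (pair1_measurable w)). Qed.

Let mbf d1 (Z : measurableType d1) (f : Z -> W) (g : Z -> T) :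
  measurable_fun setT f -> measurable_fun setT g ->
  measurable_fun setT (fun z => b (f z) (g z)).
Proof. by move=> mf mg; exact: (measurableT_comp mb (measurable_fun_pair mf mg)). Qed.

Lemma measurable_gram_kernel :
  measurable_fun [set: T * T] (fun z => gram_kernel z.1 z.2).
Proof.
apply: (@measurable_fun_fubini_tonelli_F _ _ _ _ R mu
  (fun z : (T * T) * W => (b z.2 z.1.1 * b z.2 z.1.2)%:E)).
- apply/measurable_EFinP/measurable_funM; apply: mbf => //.
    exact: (measurableT_comp measurable_fst measurable_fst).
  exact: (measurableT_comp measurable_snd measurable_fst).
- by move=> z; rewrite lee_fin mulr_ge0.
Qed.

Lemma gram_mass_fin_num rho w : gram_mass rho w \is a fin_num.
Proof.
rewrite ge0_fin_numE ?gram_mass_ge0//.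
apply: (@le_lt_trans _ _ (\int[rho]_p (M w)%:E)).
  apply: ge0_le_integral => //.
  - by move=> p _; rewrite lee_fin.
  - exact/measurable_EFinP.
  - by move=> p _; rewrite lee_fin.
by rewrite integral_cst//= probability_setT mule1 ltry.
Qed.

Lemma measurable_gram_mass rho : measurable_fun setT (gram_mass rho).
Proof.
apply: (@measurable_fun_fubini_tonelli_F _ _ _ _ R rho (fun z => (b z.1 z.2)%:E)).
  exact/measurable_EFinP.
by move=> z; rewrite lee_fin.
Qed.

Lemma integral_gram_kernelr tau p :
  \int[tau]_q gram_kernel p q = \int[mu]_w ((b w p)%:E * gram_mass tau w).
Proof.
rewrite (@fubini_tonelli _ _ _ _ R tau mu (fun z => (b z.2 p * b z.2 z.1)%:E))/=.
- apply: eq_integral => w _; rewrite /gram_mass -ge0_integralZl_EFin//.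
  + by move=> q _; rewrite lee_fin.
  + exact/measurable_EFinP.
- by apply/measurable_EFinP/measurable_funM; exact: mbf.
- by move=> z; rewrite lee_fin mulr_ge0.
Qed.

Lemma integral_gram_kernel rho tau :
  \int[rho]_p \int[tau]_q gram_kernel p q =
  \int[mu]_w (gram_mass rho w * gram_mass tau w).
Proof.
under eq_integral do rewrite integral_gram_kernelr.
rewrite (@fubini_tonelli _ _ _ _ R rho mu
  (fun z => (b z.2 z.1)%:E * gram_mass tau z.2))/=.
- apply: eq_integral => w _; rewrite /= -ge0_integralZr//.
  + exact/measurable_EFinP.
  + by move=> q _; rewrite lee_fin.
  + exact: gram_mass_ge0.
- apply: emeasurable_funM.
    by apply/measurable_EFinP; exact: mbf.
  by apply: (measurableT_comp (measurable_gram_mass tau)).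
- by move=> z; rewrite mule_ge0 ?gram_mass_ge0// lee_fin.
Qed.

Definition gram_dist rho tau :=
  \int[mu]_w ((fine (gram_mass rho w) - fine (gram_mass tau w)) ^+ 2)%:E.

(** Pointwise this is [2 u v + (u - v)^2 = u^2 + v^2] for the two masses, finite because [b w] is
    bounded by [M w]. The additive form is meaningful even when the integrals are infinite. *)
Lemma gram_dist_identity rho tau :
  \int[rho \x tau]_z gram_kernel z.1 z.2 + \int[tau \x rho]_z gram_kernel z.1 z.2 +
    gram_dist rho tau =
  \int[rho \x rho]_z gram_kernel z.1 z.2 + \int[tau \x tau]_z gram_kernel z.1 z.2.
Proof.
have mB := measurable_gram_mass.
have mBB r t : measurable_fun setT (fun w => gram_mass r w * gram_mass t w).
  exact: emeasurable_funM.
have B0 r t w : 0 <= gram_mass r w * gram_mass t w.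
  by rewrite mule_ge0// gram_mass_ge0.
have mD : measurable_fun setT
    (fun w => ((fine (gram_mass rho w) - fine (gram_mass tau w)) ^+ 2)%:E).
  apply/measurable_EFinP/measurable_funX/measurable_funB; exact: measurableT_comp.
have E (r t : probability T R) : \int[r \x t]_z gram_kernel z.1 z.2 =
    \int[mu]_w (gram_mass r w * gram_mass t w).
  rewrite -integral_gram_kernel fubini_tonelli1//; first exact: measurable_gram_kernel.
  by move=> z; exact: gram_kernel_ge0.
rewrite !E /gram_dist -!ge0_integralD//.
- apply: eq_integral => w _.
  rewrite -(fineK (gram_mass_fin_num rho w)) -(fineK (gram_mass_fin_num tau w)).
  by rewrite -!EFinM -!EFinD/=; congr EFin; ring.
- by move=> w _; rewrite adde_ge0.
- exact: emeasurable_funD.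
- by move=> w _; rewrite lee_fin sqr_ge0.
Qed.

End gram_kernel.

(** Continuity fails at 0, so the inverse is expressed as [expR (- ln x)] on the positive half line,
    by oddness on the negative one, and by the convention [0^-1 = 0]. *)
Lemma measurable_inv {R : realType} : measurable_fun [set: R] (@GRing.inv R).
Proof.
have -> : @GRing.inv R = fun x => if 0 < x then expR (- ln x)
    else if 0 < - x then - expR (- ln (- x)) else 0.
  apply/funext => x; case: ifPn => [x0|]; first by rewrite expRN lnK ?posrE.
  rewrite -leNgt => x0; case: ifPn => [nx0|]; first by rewrite expRN lnK ?posrE// invrN opprK.
  by rewrite oppr_gt0 -leNgt => x0'; rewrite (le_anti (_ : x <= 0 <= x)) ?x0// invr0.
have mel : measurable_fun [set: R] (fun x => expR (- ln x)).
  apply: measurableT_comp; first exact: measurable_expR.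
  by apply: measurableT_comp => //; exact: measurable_ln.
apply: measurable_fun_ifT => //; first exact: measurable_fun_ltr.
apply: measurable_fun_ifT => //; first exact: measurable_fun_ltr.
apply: measurableT_comp => //.
exact: (measurableT_comp mel).
Qed.

(* Interval indicators as features: two points at distance [t] lie in a common
   interval of length [r] for a set of translates of measure [max (r - t) 0],
   and [\int_0^S max (r - t) 0 / r ^ 2 dr = ln (S / t) - 1 + t / S]. The cutoff
   [S = expR n.+1] turns this into [n - ln t + t / S]. *)
Section box_kernel.
Context {R : realType}.
Local Notation leb := (@lebesgue_measure R).
Local Notation mR := (measurableTypeR R).
Implicit Types (p q r t e S x : R) (n : nat).
Local Open Scope ereal_scope.

(** [z.1] is the length of the interval and [z.2] its left end; the height [1 / z.1] produces the
    weight [1 / r ^ 2] in products of two features. *)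
Definition box n (z : mR * mR) (p : R) : R :=
  if [&& 0 < z.1, z.1 <= expR n.+1%:R, z.2 <= p & p < z.2 + z.1]%R
  then (z.1^-1)%R else 0%R.

Lemma box_ge0 n z p : (0 <= box n z p)%R.
Proof. by rewrite /box; case: ifPn => // /and4P[z0 _ _ _]; rewrite invr_ge0 ltW. Qed.

Lemma box_le n z p : (box n z p <= `|z.1^-1|)%R.
Proof. by rewrite /box; case: ifPn => // _; rewrite ler_norm. Qed.

Lemma measurable_box n : measurable_fun [set: mR * mR * R] (fun z => box n z.1 z.2).
Proof.
have m1 : measurable_fun [set: mR * mR * R] (fun z => z.1.1 : R).
  exact: (measurableT_comp measurable_fst measurable_fst).
have m2 : measurable_fun [set: mR * mR * R] (fun z => z.1.2 : R).
  exact: (measurableT_comp measurable_snd measurable_fst).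
apply: measurable_fun_ifT => //.
- apply: measurable_and; first exact: measurable_fun_ltr.
  apply: measurable_and; first exact: measurable_fun_ler.
  apply: measurable_and; first exact: measurable_fun_ler.
  by apply: measurable_fun_ltr => //; exact: measurable_funD.
- exact: (measurableT_comp measurable_inv m1).
Qed.

Definition tent_integral S t := \int[leb]_(r in `]0%R, S]) (Num.max (r - t) 0 / r ^+ 2)%:E.

Let tent_ge0 t r : (0 <= Num.max (r - t) 0 / r ^+ 2)%R.
Proof. by rewrite divr_ge0 ?sqr_ge0// le_max lexx orbT. Qed.

Let measurable_tent t (D : set R) :
  measurable_fun D (fun r => (Num.max (r - t) 0 / r ^+ 2)%:E).
Proof.
apply/measurable_EFinP/measurable_funTS/measurable_funM.
  by apply: measurable_maxr => //; exact: measurable_funB.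
by apply: (measurableT_comp measurable_inv); exact: measurable_funX.
Qed.

Definition leb2 : set (mR * mR) -> \bar R := leb \x leb.

HB.instance Definition _ := Measure.on leb2.

Let leb2_sigma_finite : sigma_finite setT leb2.
Proof.
have /sigma_finiteP[F [TF ndF Foo]] := sigma_finiteT leb.
exists (fun n => F n `*` F n).
  rewrite -setXTT TF predeqE => -[x y]; split.
    move=> [/= [n _ Fnx] [k _ Fky]]; exists (maxn n k) => //; split.
    - by move: x Fnx; exact/subsetPset/ndF/leq_maxl.
    - by move: y Fky; exact/subsetPset/ndF/leq_maxr.
  by move=> [n _ []/= ? ?]; split; exists n.
move=> k; have [? ?] := Foo k; split; first exact: measurableX.
by rewrite /leb2 product_measure1E// lte_mul_pinfty// ge0_fin_numE.
Qed.

HB.instance Definition _ := Measure_isSigmaFinite.Build _ _ _ leb2 leb2_sigma_finite.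

Lemma gram_kernel_box n p q :
  gram_kernel leb2 (box n) p q = tent_integral (expR n.+1%:R) `|p - q|%R.
Proof.
rewrite /gram_kernel /leb2 fubini_tonelli1/=; last 2 first.
- apply/measurable_EFinP/measurable_funM.
    exact: (measurableT_comp (measurable_box n) (pair2_measurable p)).
  exact: (measurableT_comp (measurable_box n) (pair2_measurable q)).
- by move=> z; rewrite lee_fin mulr_ge0// box_ge0.
rewrite /fubini_F /tent_integral [RHS]integral_mkcond; apply: eq_integral => r _.
rewrite patchE; case: ifPn; last first.
  rewrite notin_setE/= in_itv/= => /negP rS.
  rewrite integral0_eq// => u _; rewrite /box/= [X in (X * _)%:E]ifF ?mul0r//.
  by apply: contraNF rS => /and4P[-> ->].
rewrite inE/= in_itv/= => /andP[r0 rS].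
(* The left ends [u] for which [[u, u + r[] contains both [p] and [q]. *)
pose A := `](Num.max p q - r)%R, Num.min p q]%classic : set R.
have mA : measurable A by exact: measurable_itv.
transitivity (\int[leb]_u (((r^-1) ^+ 2)%:E * (\1_A u)%:E)).
  apply: eq_integral => u _; rewrite /box/= r0 rS/= indicE -EFinM.
  have -> : (u \in A) = ((u <= p) && (p < u + r) && ((u <= q) && (q < u + r)))%R.
    apply/idP/idP.
      rewrite inE /A/= in_itv/= ltrBlDr gt_max le_min.
      by move=> /andP[/andP[-> ->] /andP[-> ->]].
    move=> /andP[/andP[h1 h2] /andP[h3 h4]].
    by rewrite inE /A/= in_itv/= ltrBlDr gt_max le_min h1 h2 h3 h4.
  by congr EFin; case: ifPn => _; case: ifPn => _ /=; rewrite ?mulr0 ?mul0r ?mulr1 ?expr2.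
rewrite ge0_integralZl//; last 2 first.
- exact/measurable_EFinP/measurable_indic.
- by rewrite lee_fin sqr_ge0.
rewrite integral_indic// setIT.
have lebA : leb A = (Num.max (r - `|p - q|) 0)%R%:E.
  rewrite /A /= lebesgue_measure_itv/= lte_fin.
  have h : (Num.max p q - Num.min p q = `|p - q|)%R.
    case: (leP p q) => pq; first by rewrite distrC ger0_norm// subr_ge0.
    by rewrite gtr0_norm// subr_gt0.
  rewrite -h; move: (Num.max p q) (Num.min p q) => M m; case: ifPn => hr.
    by rewrite max_l; [congr EFin; ring|lra].
  by rewrite max_r//; move: hr; rewrite -leNgt; lra.
by rewrite [X in _ * X]lebA -EFinM exprVn mulrC.
Qed.

Let tent_ftc S e t : (0 < e)%R -> (e <= S)%R -> (t <= e)%R ->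
  \int[leb]_(r in `[e, S]) (Num.max (r - t) 0 / r ^+ 2)%:E =
  ((ln S + t / S) - (ln e + t / e))%:E.
Proof.
move=> e0; rewrite le_eqVlt => /predU1P[<- te|eS te].
  by rewrite set_itv1 integral_set1 subrr.
have pos r : (r \in `[e, S])%R -> (0 < r)%R.
  by rewrite in_itv/= => /andP[er _]; rewrite (lt_le_trans e0).
transitivity (\int[leb]_(r in `[e, S]) (r^-1 - t / r ^+ 2)%:E).
  apply: eq_integral => r; rewrite inE/= => rI; have r0 := pos _ rI.
  rewrite max_l; last by move: rI; rewrite in_itv/= subr_ge0 => /andP[/(le_trans te)].
  by congr EFin; field; rewrite gt_eqF.
have dF r : (r \in `[e, S])%R -> is_derive r (1%R : R) (fun r => ln r + t / r)%R (r^-1 - t / r ^+ 2)%R.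
  move=> /pos r0; have dl := is_derive1_ln r0.
  have dV : is_derive r (1%R : R) (fun r : R => r^-1)%R (- (r ^- 2))%R.
    apply: (@is_derive_eq _ _ _ _ _ _ _ _ (is_deriveV (lt0r_neq0 r0) (is_derive_id r (1%R : R)))).
    by rewrite /GRing.scale/= mulr1.
  apply: is_derive_eq; rewrite /GRing.scale/=; ring.
have cF r : (r \in `[e, S])%R -> {for r, continuous (fun r => ln r + t / r)%R}.
  by move=> /dF h; apply/differentiable_continuous/derivable1_diffP; case: h.
rewrite (@continuous_FTC2 _ _ (fun r => ln r + t / r)%R)//.
- apply: continuous_in_subspaceT => r; rewrite inE/= => /pos r0.
  apply: cvgB; first by apply: cvgV; [exact: lt0r_neq0|exact: cvg_id].
  apply: cvgM; first exact: cvg_cst.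
  apply: cvgV; first by rewrite expf_neq0// lt0r_neq0.
  exact: exprn_continuous.
- split.
  + by move=> r /subset_itv_oo_cc/dF[].
  + by apply: cvg_at_right_filter; apply: cF; rewrite in_itv/= lexx ltW.
  + by apply: cvg_at_left_filter; apply: cF; rewrite in_itv/= lexx ltW.
- by move=> r /subset_itv_oo_cc/dF h; rewrite derive1E; apply: derive_val.
Qed.

Lemma tent_integral_ge S e t : (0 < e)%R -> (e <= S)%R -> (t <= e)%R ->
  ((ln S + t / S) - (ln e + t / e))%:E <= tent_integral S t.
Proof.
move=> e0 eS te; rewrite -tent_ftc//; apply: ge0_subset_integral => //.
- exact: measurable_tent.
- by move=> r _; rewrite lee_fin.
- by apply: subset_itvr; rewrite bnd_simp.
Qed.

Lemma tent_integralE S t : (0 < t)%R -> (t <= S)%R ->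
  tent_integral S t = (ln S + t / S - ln t - 1)%:E.
Proof.
move=> t0 tS.
transitivity (\int[leb]_(r in `[t, S]) (Num.max (r - t) 0 / r ^+ 2)%:E).
  rewrite /tent_integral [LHS]integral_mkcond [RHS]integral_mkcond.
  apply: eq_integral => r _; rewrite !patchE.
  case: ifPn => [|h1]; case: ifPn => [|h2] //.
  - rewrite inE/= in_itv/= => /andP[r0 rS].
    move: h2; rewrite notin_setE/= in_itv/= rS andbT => /negP; rewrite -ltNge => rt.
    by rewrite max_r ?mul0r// subr_le0 ltW.
  - move: h1; rewrite inE notin_setE/= !in_itv/= => h1 /andP[tr rS].
    by case: h1; rewrite rS (lt_le_trans t0 tr).
rewrite tent_ftc// divff ?gt_eqF//; congr EFin; ring.
Qed.

Lemma tent_integral0 S t : (S <= t)%R -> tent_integral S t = 0.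
Proof.
move=> St; apply: integral0_eq => r; rewrite /= in_itv/= => /andP[_ rS].
by rewrite max_r ?mul0r// subr_le0 (le_trans rS).
Qed.

Lemma tent_integral_diag S : (0 < S)%R -> tent_integral S 0 = +oo.
Proof.
move=> S0; apply: eq_infty => A.
(* At [t = 0] the lower bound is [ln S - ln e], which this choice makes at least [A]; the minimum
   with [S] covers negative [A]. *)
pose e := (Num.min S (S * expR (- A)))%R.
have e0 : (0 < e)%R by rewrite lt_min S0 mulr_gt0// expR_gt0.
apply: le_trans (@tent_integral_ge S e 0 e0 _ (ltW e0)); last by rewrite ge_min lexx.
rewrite lee_fin !mul0r !addr0.
have : (ln e <= ln (S * expR (- A)))%R.
  by rewrite ler_ln ?posrE ?mulr_gt0 ?expR_gt0// ge_min lexx orbT.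
by rewrite lnM ?posrE ?expR_gt0// expRK; lra.
Qed.

(** Below the cutoff the excess over [nlog + n] is exactly [t / S]. Beyond it the Gram kernel is 0,
    and this bound and the next reduce to [ln t >= n + 1] and to [ln (t / S) <= t / S - 1]. *)
Lemma gram_kernel_box_ge n p q :
  nlog (p - q)%R + n%:R%:E <= gram_kernel leb2 (box n) p q.
Proof.
rewrite gram_kernel_box /nlog; case: eqVneq => [->|pq0].
  by rewrite normr0 tent_integral_diag ?leey ?expR_gt0.
have t0 : (0 < `|p - q|)%R by rewrite normr_gt0.
move: (`|p - q|%R) t0 => t t0.
have [tS|/ltW St] := leP t (expR n.+1%:R).
  rewrite tent_integralE// -EFinD lee_fin expRK -natr1.
  have : (0 <= t / expR (n%:R + 1))%R by rewrite divr_ge0 ?expR_ge0 ?ltW.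
  by lra.
rewrite tent_integral0// -EFinD lee_fin.
have := St; rewrite -ler_ln ?posrE ?expR_gt0// expRK -natr1; lra.
Qed.

Lemma gram_kernel_box_le n p q :
  gram_kernel leb2 (box n) p q <=
  nlog (p - q)%R + (n%:R + expR (- n.+1%:R) * `|p - q|)%:E.
Proof.
rewrite gram_kernel_box /nlog; case: eqVneq => [_|pq0].
  by rewrite addye// leey.
have t0 : (0 < `|p - q|)%R by rewrite normr_gt0.
rewrite expRN; move: (`|p - q|%R) t0 => t t0.
have [tS|/ltW St] := leP t (expR n.+1%:R).
  rewrite tent_integralE// -EFinD lee_fin expRK -natr1.
  by rewrite [(_^-1 * t)%R]mulrC; lra.
rewrite tent_integral0// -EFinD lee_fin.
have := @le_ln1Dx R (t / expR n.+1%:R - 1).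
rewrite addrCA subrr addr0 ltrBrDr addNr divr_gt0// => /(_ isT).
rewrite ln_div ?posrE// expRK -natr1 [(_^-1 * t)%R]mulrC; lra.
Qed.

End box_kernel.

Lemma integral_cst_prob {R : realType} d (T : measurableType d) (P : probability T R) (c : \bar R) :
  (\int[P]_x c = c)%E.
Proof.
apply: (etrans (integral_cst P measurableT c)); rewrite -[RHS]mule1.
by congr (_ * _)%E; exact: probability_setT.
Qed.

(** * Conditional positivity of the logarithmic interaction *)

Section log_gas_energy.
Context {R : realType}.
Implicit Types (rho tau : probability R R) (n m : nat).
Local Open Scope ereal_scope.

Definition interaction rho tau := \int[rho \x tau]_z k1 z.1 z.2.

Definition box_dist n rho tau := gram_dist leb2 (box n) rho tau.

Let quad (z : R * R) : \bar R := (2^-1 * (z.1 ^+ 2 + z.2 ^+ 2))%:E.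

Let K n (z : R * R) := gram_kernel leb2 (box n) z.1 z.2.

Let mquad : measurable_fun setT quad.
Proof.
apply/measurable_EFinP/measurable_funM => //.
by apply: measurable_funD; exact: measurable_funX.
Qed.

Let quad_ge0 z : 0 <= quad z.
Proof. by rewrite lee_fin mulr_ge0// addr_ge0// sqr_ge0. Qed.

Let mK n : measurable_fun setT (K n).
Proof. by apply: measurable_gram_kernel => *; [exact: box_ge0|exact: measurable_box]. Qed.

Let K_ge0 n z : 0 <= K n z.
Proof. by apply: gram_kernel_ge0 => *; exact: box_ge0. Qed.

Let integral_quad rho tau : \int[rho \x tau]_z quad z =
  \int[rho]_p (2^-1 * p ^+ 2)%:E + \int[tau]_q (2^-1 * q ^+ 2)%:E.
Proof.
have m2 : measurable_fun [set: R] (fun p : R => (2^-1 * p ^+ 2)%:E).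
  by apply/measurable_EFinP/measurable_funM => //; exact: measurable_funX.
have p0 (p : R) : 0 <= (2^-1 * p ^+ 2)%:E by rewrite lee_fin mulr_ge0// sqr_ge0.
rewrite fubini_tonelli1// /fubini_F/quad/=.
transitivity (\int[rho]_p ((2^-1 * p ^+ 2)%:E + \int[tau]_q (2^-1 * q ^+ 2)%:E)).
  apply: eq_integral => p _; under eq_integral do rewrite mulrDr EFinD.
  rewrite ge0_integralD//; [|by move=> q _; exact: p0..].
  by rewrite integral_cst_prob.
rewrite ge0_integralD//.
- by rewrite (integral_cst_prob rho).
- by move=> p _; apply: integral_ge0 => q _; exact: p0.
Qed.

Lemma interaction_ge0 rho tau : 0 <= interaction rho tau.
Proof. by apply: integral_ge0 => z _; exact: k1_ge0. Qed.

Let measurable_box_dist n rho tau : measurable_fun setT (fun w =>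
  ((fine (gram_mass (box n) rho w) - fine (gram_mass (box n) tau w)) ^+ 2)%:E).
Proof.
have mB r := @measurable_gram_mass _ _ _ _ R (box n) (@box_ge0 R n) (@measurable_box R n) r.
by apply/measurable_EFinP/measurable_funX/measurable_funB; exact: measurableT_comp.
Qed.

(** A larger cutoff keeps the features already present and adds longer intervals. Hence a distance
    at a fixed cutoff survives the limit in [n]. *)
Lemma le_box_dist m n rho tau : (m <= n)%N -> box_dist m rho tau <= box_dist n rho tau.
Proof.
move=> mn; apply: ge0_le_integral.
- exact: measurableT.
- by move=> w _; rewrite lee_fin sqr_ge0.
- exact: measurable_box_dist.
- exact: measurable_box_dist.
move=> w _; rewrite lee_fin.
have [wm|wm] := boolP ((0 < w.1) && (w.1 <= expR m.+1%:R))%R; last first.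
  have z0 r : gram_mass (box m) r w = 0.
    apply: integral0_eq => p _; rewrite /box ifF//.
    by apply: contraNF wm => /and4P[-> ->].
  by rewrite !z0 subrr expr0n/= sqr_ge0.
have e r : gram_mass (box m) r w = gram_mass (box n) r w.
  apply: eq_integral => p _; congr EFin; rewrite /box.
  have -> : (w.1 <= expR n.+1%:R)%R.
    case/andP : wm => _ /le_trans; apply; rewrite ler_expR ler_nat ltnS//.
  by case/andP : wm => -> ->.
by rewrite !e.
Qed.

Let E n rho tau := \int[rho \x tau]_z (K n z + quad z).

(** The quadratic part is a sum of one moment of each law, so it contributes the same to both sides
    of the Gram identity. *)
Let E_identity n rho tau :
  E n rho tau + E n tau rho + box_dist n rho tau = E n rho rho + E n tau tau.
Proof.
have split (r t : probability R R) :
    E n r t = \int[r \x t]_z K n z + \int[r \x t]_z quad z.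
  by rewrite /E ge0_integralD//; exact: mK.
have := gram_dist_identity leb2 (@box_ge0 R n) (@box_le R n) (@measurable_box R n) rho tau.
rewrite !split !integral_quad -/(box_dist n rho tau).
move: (\int[rho]_p _) (\int[tau]_p _) (box_dist n rho tau) => a b D G.
rewrite addeACA addeAC [X in X + _ = _]G [RHS]addeACA; congr (_ + _).
by rewrite [b + a]addeC addeACA.
Qed.

Let le_interaction_E n rho tau : interaction rho tau + n%:R%:E <= E n rho tau.
Proof.
rewrite /interaction -{1}(integral_cst_prob (rho \x tau)%E n%:R%:E).
rewrite -ge0_integralD//; last 2 first.
- by move=> z _; exact: k1_ge0.
- exact: measurable_k1.
apply: ge0_le_integral => //.
- by move=> z _; rewrite adde_ge0 ?k1_ge0// lee_fin.
- by apply: emeasurable_funD => //; exact: measurable_k1.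
- by apply: emeasurable_funD => //; exact: mK.
move=> z _; rewrite /k1 addeAC; apply: leeD => //.
exact: gram_kernel_box_ge.
Qed.

(** The error [expR (- n.+1) * |p - q|] is absorbed through [|p - q| <= k1 p q + 3], whence the
    factor on the interaction and the constant 3. *)
Let E_le_interaction n rho : E n rho rho <=
  (1 + expR (- n.+1%:R))%:E * interaction rho rho + (n%:R + 3 * expR (- n.+1%:R))%:E.
Proof.
set c := (n%:R + 3 * expR (- n.+1%:R) : R)%R.
have c0 : (0 <= c)%R by rewrite addr_ge0// mulr_ge0// expR_ge0.
have d0 : (0 <= expR (- n.+1%:R) :> R)%R by exact: expR_ge0.
rewrite /interaction -{1}(integral_cst_prob (rho \x rho)%E c%:E).
rewrite -ge0_integralZl//; last 2 first.
- exact: measurable_k1.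
- by move=> z _; exact: k1_ge0.
rewrite -ge0_integralD//; last 2 first.
- by move=> z _; rewrite mule_ge0 ?k1_ge0// lee_fin addr_ge0.
- by apply: emeasurable_funM => //; exact: measurable_k1.
apply: ge0_le_integral => //.
- by move=> z _; rewrite adde_ge0.
- by apply: emeasurable_funD => //; exact: mK.
- by apply: emeasurable_funD => //; apply: emeasurable_funM => //; exact: measurable_k1.
move=> z _; apply: (@le_trans _ _ (k1 z.1 z.2 +
    (n%:R + expR (- n.+1%:R) * `|z.1 - z.2|)%:E)).
  rewrite /k1 [leRHS]addeAC; apply: leeD => //.
  rewrite /K.
  exact: gram_kernel_box_le.
have := k1_ge z.1 z.2; have := k1_ge0 z.1 z.2.
case: (k1 z.1 z.2) => [k| |] // k0 kd; last first.
  by rewrite addye// gt0_muley ?addye ?leey// lte_fin ltr_wpDr.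
rewrite -EFinM -!EFinD lee_fin.
move: kd; rewrite lee_fin => kd.
by rewrite /c; move: d0; move: (expR _) => D D0; nra.
Qed.

(** Each side of the identity for [E n] carries the divergent constant [2 * n], which cancels; the
    error tends to 0 and [box_dist n] dominates [box_dist m]. An infinite self interaction makes the
    bound trivial. *)
Lemma interaction_box_dist m rho tau :
  interaction rho tau + interaction tau rho + box_dist m rho tau <=
  interaction rho rho + interaction tau tau.
Proof.
have [Joo|] := boolP ((interaction rho rho == +oo) || (interaction tau tau == +oo)).
  suff -> : interaction rho rho + interaction tau tau = +oo by exact: leey.
  case/orP : Joo => /eqP ->; rewrite ?addye// ?addey//.
  - by rewrite gt_eqF// (lt_le_trans _ (interaction_ge0 _ _))// ltNyr.
  - by rewrite gt_eqF// (lt_le_trans _ (interaction_ge0 _ _))// ltNyr.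
rewrite negb_or -!ltey.
rewrite -!ge0_fin_numE ?interaction_ge0// => /andP[fr ft].
pose jr := fine (interaction rho rho); pose jt := fine (interaction tau tau).
have Er : interaction rho rho = jr%:E by rewrite /jr fineK.
have Et : interaction tau tau = jt%:E by rewrite /jt fineK.
have jr0 : (0 <= jr)%R by rewrite -lee_fin -Er interaction_ge0.
have jt0 : (0 <= jt)%R by rewrite -lee_fin -Et interaction_ge0.
apply/lee_addgt0Pr => e e0.
(* The total error is [expR (- n.+1) * A]: the two self interactions, plus twice the constant 3. *)
pose A : R := (jr + jt + 6)%R.
(* Then [A / e < n + 1 <= expR (n + 1)], and [m <= n]. *)
pose n := maxn m (Num.truncn (A / e)%R).
have dn : (expR (- n.+1%:R) * A <= e)%R.
  rewrite expRN mulrC ler_pdivrMr ?expR_gt0// mulrC -ler_pdivrMr//.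
  apply: (@le_trans _ _ n.+1%:R%R).
    apply: ltW; apply: (lt_le_trans (Num.Theory.truncnS_gt _)).
    by rewrite ler_nat ltnS leq_maxr.
  by apply: le_trans (expR_ge1Dx _); rewrite lerDr.
have := E_identity n rho tau; set D := box_dist n rho tau => En.
have : interaction rho tau + n%:R%:E + (interaction tau rho + n%:R%:E) + box_dist m rho tau <=
    ((1 + expR (- n.+1%:R)) * (jr + jt) + 2 * (n%:R + 3 * expR (- n.+1%:R)))%:E.
  apply: (@le_trans _ _ (E n rho rho + E n tau tau)).
    rewrite -En; apply: leeD; last by apply: le_box_dist; exact: leq_maxl.
    by apply: leeD; exact: le_interaction_E.
  apply: (le_trans (leeD (E_le_interaction n rho) (E_le_interaction n tau))).
  by rewrite Er Et -!EFinM -!EFinD lee_fin; lra.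
rewrite addeACA -EFinD addeAC -leeBrDr// => /le_trans; apply.
rewrite Er Et -EFinB -!EFinD lee_fin.
by move: dn; rewrite /A; move: (expR _) => d; lra.
Qed.

End log_gas_energy.

(** * Quantitative minimality of the semicircle law *)

Section semicircle_minimality.
Context {R : realType}.
Local Notation s2 := (Num.sqrt 2 : R).
Local Notation sc := (@semicircle R).
Implicit Types rho : probability R R.
Local Open Scope ereal_scope.

Lemma interaction_sc_l rho : interaction sc rho = interaction rho sc.
Proof.
rewrite /interaction fubini_tonelli2; first last.
- by move=> z; exact: k1_ge0.
- exact: measurable_k1.
rewrite fubini_tonelli1; first last.
- by move=> z; exact: k1_ge0.
- exact: measurable_k1.
apply: eq_integral => q _; apply: eq_integral => p _.
by rewrite /= /k1 -nlogN opprB [(q ^+ 2 + _)%R]addrC.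
Qed.

Let measurable_potential : measurable_fun [set: R] (fun p => \int[sc]_q k1 p q).
Proof.
apply: (@measurable_fun_fubini_tonelli_F _ _ _ _ R sc (fun z => k1 z.1 z.2)).
  exact: measurable_k1.
by move=> z; exact: k1_ge0.
Qed.

Let interaction_sc_r rho : interaction rho sc = \int[rho]_p \int[sc]_q k1 p q.
Proof.
by rewrite /interaction fubini_tonelli1; [|exact: measurable_k1|move=> z; exact: k1_ge0].
Qed.

Lemma interaction_sc_ge rho : potential_min%:E <= interaction rho sc.
Proof.
rewrite interaction_sc_r -(integral_cst_prob rho potential_min%:E).
have [c0|c0] := leP 0%R (@potential_min R).
  apply: ge0_le_integral => //.
  by move=> p _; exact: potential_ge.
apply: (@le_trans _ _ 0).
  by rewrite integral_cst_prob lee_fin ltW.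
by apply: integral_ge0 => p _; apply: integral_ge0 => q _; exact: k1_ge0.
Qed.

Lemma interaction_sc_sc : interaction sc sc = potential_min%:E.
Proof.
have V0 p : 0 <= \int[sc]_q k1 p q by apply: integral_ge0 => q _; exact: k1_ge0.
have c0 : (0 <= @potential_min R)%R.
  by rewrite -lee_fin -(@potential_segment R 0) ?V0// oppr_le0 ltW.
rewrite interaction_sc_r ge0_integral_semicircle//.
rewrite -[RHS](integral_cst_prob sc) ge0_integral_semicircle//.
apply: eq_integral => p; rewrite inE/= in_itv/= => ps.
by rewrite potential_segment.
Qed.

(** Both cross interactions with [sc] are at least [potential_min], and one of them is offset by the
    self interaction of [sc], which equals it. The excess energy thus controls every [box_dist]. *)
Lemma semicircle_energy_le m rho :
  potential_min%:E + box_dist m rho sc <= interaction rho rho.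
Proof.
have := interaction_box_dist m rho sc.
rewrite interaction_sc_l interaction_sc_sc => h.
rewrite -(leeD2rE _ _ (_ : (@potential_min R)%:E \is a fin_num))//.
apply: le_trans h; rewrite [leRHS]addeAC; apply: leeD; last exact: interaction_sc_ge.
by rewrite leeD2r// interaction_sc_ge.
Qed.

End semicircle_minimality.

(** * Vanishing box distances determine the law *)

Section box_dist_separates.
Context {R : realType}.
Local Notation leb := (@lebesgue_measure R).
Implicit Types (rho tau : probability R R) (r u a b : R).
Local Open Scope ereal_scope.

Lemma ae_itvoo (P : R -> Prop) a b : (a < b)%R ->
  {ae leb, forall x, P x} -> exists2 x : R, (a < x < b)%R & P x.
Proof.
move=> ab aP; apply: contrapT => h.
have : leb.-negligible (`]a, b[%classic : set R).
  apply: negligibleS aP => x /=; rewrite in_itv/= => xab Px.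
  by apply: h; exists x.
move=> /negligibleP; rewrite /= lebesgue_measure_itv/= lte_fin ab.
move=> /(_ (measurable_itv _)) /eqP; rewrite -EFinB eqe subr_eq0 => /eqP ba.
by move: ab; rewrite ba ltxx.
Qed.

Let gram_mass_box n rho r u : (0 < r)%R -> (r <= expR n.+1%:R)%R ->
  gram_mass (box n) rho (r, u) = r^-1%:E * rho `[u, (u + r)%R[%classic.
Proof.
move=> r0 rS; rewrite /gram_mass.
transitivity (\int[rho]_p (r^-1%:E * (\1_(`[u, (u + r)%R[%classic : set R) p)%:E)).
  apply: eq_integral => p _; rewrite /box/= r0 rS/= indicE -EFinM.
  have -> : (p \in (`[u, (u + r)%R[%classic : set R)) = ((u <= p) && (p < u + r))%R.
    by apply/idP/idP; rewrite inE/= in_itv.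
  by case: ifPn => _; rewrite ?mulr1 ?mulr0.
rewrite ge0_integralZl//; last 2 first.
- by apply/measurable_EFinP; apply: measurable_indic; exact: measurable_itv.
- by rewrite lee_fin invr_ge0 ltW.
by rewrite integral_indic ?setIT//; exact: measurable_itv.
Qed.

Let same_box rho tau r :=
  {ae leb, forall u, rho `[u, (u + r)%R[%classic = tau `[u, (u + r)%R[%classic}.

(** A zero integral of squares vanishes for almost every length and then for almost every left end;
    multiplying by the length removes the height of the box. *)
Lemma box_dist_eq0 n rho tau : box_dist n rho tau = 0 ->
  {ae leb, forall r, (0 < r)%R -> (r <= expR n.+1%:R)%R -> same_box rho tau r}.
Proof.
have mB t := @measurable_gram_mass _ _ _ _ R (box n) (@box_ge0 R n) (@measurable_box R n) t.
pose f w : \bar R :=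
  ((fine (gram_mass (box n) rho w) - fine (gram_mass (box n) tau w)) ^+ 2)%:E.
have mf : measurable_fun setT f.
  by apply/measurable_EFinP/measurable_funX/measurable_funB; exact: measurableT_comp.
have f0 w : 0 <= f w by rewrite lee_fin sqr_ge0.
rewrite /box_dist /gram_dist -/f /leb2 fubini_tonelli1//.
set G := fubini_F _ _.
have mG : measurable_fun setT G by exact: measurable_fun_fubini_tonelli_F.
have G0 r : 0 <= G r by apply: integral_ge0 => u _; exact: f0.
move=> IG0.
have /(ae_eq_integral_abs leb measurableT mG) : \int[leb]_r `|G r| = 0.
  by rewrite -IG0; apply: eq_integral => r _; rewrite gee0_abs.
apply: filterS => r /= /(_ I) Gr0 r0 rS.
have mfr : measurable_fun setT (fun u => f (r, u)).
  exact: (measurableT_comp mf (pair1_measurable r)).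
have /(ae_eq_integral_abs leb measurableT mfr) : \int[leb]_u `|f (r, u)| = 0.
  by rewrite -Gr0; apply: eq_integral => u _; rewrite gee0_abs.
apply: filterS => u /= /(_ I) /eqP; rewrite /f eqe sqrf_eq0 subr_eq0 => /eqP h.
have fin t : gram_mass (box n) t (r, u) \is a fin_num.
  exact: (gram_mass_fin_num (@box_ge0 R n) (@box_le R n) (@measurable_box R n)).
have : gram_mass (box n) rho (r, u) = gram_mass (box n) tau (r, u).
  by rewrite -(fineK (fin rho)) h fineK.
rewrite !gram_mass_box// => /(congr1 (fun x => r%:E * x)).
by rewrite !muleA -!EFinM divff ?gt_eqF// !mul1e.
Qed.

Let cvg_half_line rho u :
  rho `[u, (u + k%:R)%R[%classic @[k --> \oo] --> rho `[u, +oo[%classic.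
Proof.
pose J (k : nat) := `[u, (u + k%:R)%R[%classic.
have -> : `[u, +oo[%classic = \bigcup_k J k.
  apply/seteqP; split => x; rewrite /J/= ?in_itv/= ?andbT.
    move=> ux; exists (Num.truncn (x - u)).+1 => //=.
    by rewrite in_itv/= ux -ltrBlDl Num.Theory.truncnS_gt.
  by move=> [k _ /=]; rewrite in_itv/= => /andP[].
apply: (@nondecreasing_cvg_mu _ _ _ rho J).
- by move=> k; exact: measurable_itv.
- by apply: bigcup_measurable => k _; exact: measurable_itv.
- move=> k l kl; apply/subsetPset => x; rewrite /J/= !in_itv/= => /andP[-> xk].
  by rewrite (lt_le_trans xk)// lerD2l ler_nat.
Qed.

Let cvg_half_line_left rho u :
  rho `[(u - k.+1%:R^-1)%R, +oo[%classic @[k --> \oo] --> rho `[u, +oo[%classic.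
Proof.
pose J (k : nat) := `[(u - k.+1%:R^-1)%R, +oo[%classic.
have -> : `[u, +oo[%classic = \bigcap_k J k.
  apply/seteqP; split => x; rewrite /J/= ?in_itv/= ?andbT.
    by move=> ux k _; rewrite /= in_itv/= andbT lerBlDr (le_trans ux)// lerDl.
  move=> h; rewrite leNgt; apply/negP => xu.
  have xu0 : (0 < u - x)%R by rewrite subr_gt0.
  have := h (Num.truncn (u - x)^-1)%R I; rewrite /= in_itv/= andbT.
  apply/negP; rewrite -ltNge ltrBrDr addrC -ltrBrDr.
  by rewrite -[ltRHS]invrK ltf_pV2 ?posrE ?invr_gt0// Num.Theory.truncnS_gt.
apply: (@nonincreasing_cvg_mu _ _ _ rho J).
- by rewrite (le_lt_trans (probability_le1 _ _))// ?ltry//; exact: measurable_itv.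
- by move=> k; exact: measurable_itv.
- by apply: bigcap_measurable => // k _; exact: measurable_itv.
- move=> k l kl; apply/subsetPset => x; rewrite /J/= !in_itv/= !andbT.
  by apply: le_trans; rewrite lerD2l lerN2 lef_pV2 ?posrE// ler_nat ltnS.
Qed.

(** Countably many lengths [r k >= k] share almost every left end [u]; there [[u, u + k[] lies in
    [[u, u + r k[], and [k] tends to infinity. Any other [u] is approached from the left by such
    points, since the [tau]-mass of [[u, +oo[] is a limit along decreasing half lines. *)
Let le_half_line rho tau :
  (forall k : nat, exists r : R, (k%:R <= r)%R /\ same_box rho tau r) ->
  forall u, rho `[u, +oo[%classic <= tau `[u, +oo[%classic.
Proof.
move=> /choice[r rP].
have aeu : {ae leb, forall u, rho `[u, +oo[%classic <= tau `[u, +oo[%classic}.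
  have : {ae leb, forall u, forall k : nat,
      rho `[u, (u + r k)%R[%classic = tau `[u, (u + r k)%R[%classic}.
    by apply: ae_foralln => k; case: (rP k).
  apply: negligibleS => u /=; apply: contra_not => h.
  have /cvg_lim <- // := @cvg_half_line rho u.
  apply: lime_le; first by apply/cvg_ex; eexists; exact: cvg_half_line.
  apply: nearW => k; apply: (@le_trans _ _ (rho `[u, (u + r k)%R[%classic)).
    apply: le_measure; rewrite ?inE; [exact: measurable_itv|exact: measurable_itv|].
    by apply: subset_itvl; rewrite bnd_simp lerD2l; case: (rP k).
  rewrite h; apply: le_measure; rewrite ?inE; [exact: measurable_itv|exact: measurable_itv|].
  exact: subset_itvl.
move=> u; have /cvg_lim <- // := @cvg_half_line_left tau u.
apply: lime_ge; first by apply/cvg_ex; eexists; exact: cvg_half_line_left.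
apply: nearW => k.
have [|v /andP[uv vu] h] := ae_itvoo _ aeu (a := (u - k.+1%:R^-1)%R) (b := u).
  by rewrite ltrBlDr ltrDl.
apply: (@le_trans _ _ (rho `[v, +oo[%classic)).
  apply: le_measure; rewrite ?inE; [exact: measurable_itv|exact: measurable_itv|].
  by apply: subset_itvr; rewrite bnd_simp ltW.
apply: (le_trans h).
apply: le_measure; rewrite ?inE; [exact: measurable_itv|exact: measurable_itv|].
by apply: subset_itvr; rewrite bnd_simp ltW.
Qed.

Lemma eq_half_lines rho tau :
  (forall u, rho `[u, +oo[%classic = tau `[u, +oo[%classic) ->
  forall A : set R, measurable A -> rho A = tau A.
Proof.
move=> h; apply: (@measure_unique _ _ _ (@RGenCInfty.G R)
  (fun k : nat => `[(- k%:R)%R, +oo[%classic)).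
- exact: RGenCInfty.measurableE.
- move=> A B [x ->] [y ->]; exists (Num.max x y).
  by apply/seteqP; split => z; rewrite /= !in_itv/= !andbT ge_max => /andP.
- by move=> k; exists (- k%:R)%R.
- apply/seteqP; split => // x _; exists (Num.truncn (- x)).+1 => //=.
  by rewrite in_itv/= andbT lerNl ltW// Num.Theory.truncnS_gt.
- by move=> A [x ->]; exact: h.
- by move=> k; rewrite (le_lt_trans (probability_le1 _ _))// ?ltry//.
Qed.

Lemma box_dist_separates rho tau : (forall n, box_dist n rho tau = 0) ->
  forall A : set R, measurable A -> rho A = tau A.
Proof.
move=> D0.
have H : forall k : nat, exists r : R, (k%:R <= r)%R /\ same_box rho tau r.
  (* Cutoff index [k] is large enough, because [k + 1 <= expR (k + 1)]. *)
  move=> k; have [|r /andP[kr rk] rP] := ae_itvoo _ (box_dist_eq0 (D0 k))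
    (a := k%:R) (b := k.+1%:R).
    by rewrite ltr_nat.
  exists r; split; first exact: ltW.
  apply: rP; first by rewrite (le_lt_trans _ kr).
  by rewrite (le_trans (ltW rk))// (le_trans _ (expR_ge1Dx _))// lerDr.
have same_sym r : same_box rho tau r -> same_box tau rho r.
  by apply: negligibleS => u /=; apply: contra_not => ->.
apply: eq_half_lines => u; apply/eqP; rewrite eq_le le_half_line//=.
by apply: le_half_line => k; have [r [kr /same_sym rP]] := H k; exists r.
Qed.

End box_dist_separates.

(** * Projections of planar measures *)

Section projections.
Context {R : realType}.
Local Notation leb := (@lebesgue_measure R).
Implicit Types (x y d : R * R) (f a r : R).
Local Open Scope ereal_scope.

(* The projection in direction [f], rescaled so that it is the identity on the
   second axis. *)
Definition proj f x : R := (x.2 + x.1 * (cos f / sin f))%R.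

Let sqr_sin_ge0 f : 0 <= (sin f ^+ 2)%:E :> \bar R.
Proof. by rewrite lee_fin sqr_ge0. Qed.

Let measurable_sin : measurable_fun [set: R] (@sin R).
Proof. by apply: continuous_measurable_fun; exact: continuous_sin. Qed.

Let measurable_cos : measurable_fun [set: R] (@cos R).
Proof. by apply: continuous_measurable_fun; exact: continuous_cos. Qed.

Let measurable_sqr_sin (D : set R) : measurable_fun D (fun f : R => (sin f ^+ 2)%:E).
Proof. by apply/measurable_EFinP/measurable_funTS; exact: measurable_funX. Qed.

Lemma measurable_proj : measurable_fun [set: measurableTypeR R * (R * R)]
  (fun z => proj z.1 z.2).
Proof.
have m1 : measurable_fun [set: measurableTypeR R * (R * R)] (fun z => z.1 : R).
  exact: measurable_fst.
apply: measurable_funD.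
  exact: (measurableT_comp measurable_snd measurable_snd).
apply: measurable_funM.
  exact: (measurableT_comp measurable_fst measurable_snd).
apply: measurable_funM; first exact: (measurableT_comp measurable_cos m1).
apply: (measurableT_comp measurable_inv).
exact: (measurableT_comp measurable_sin m1).
Qed.

Lemma measurable_proj1 f : measurable_fun [set: R * R] (proj f).
Proof. exact: (measurableT_comp measurable_proj (pair1_measurable f)). Qed.

Let integral_sqr_proj x :
  \int[leb]_(f in `]0%R, pi[) ((x.2 * sin f + x.1 * cos f) ^+ 2)%:E =
  (sqnorm x * (pi / 2))%:E.
Proof.
pose F f := (2^-1 * (x.2 ^+ 2 * (f - sin f * cos f) + x.1 ^+ 2 * (f + sin f * cos f))
  + x.1 * x.2 * sin f ^+ 2)%R.
have dF f : is_derive f (1%R : R) F ((x.2 * sin f + x.1 * cos f) ^+ 2)%R.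
  apply: is_derive_eq; rewrite /GRing.scale/=.
  have := cos2Dsin2 f; move: (sin f) (cos f) => s c h.
  transitivity (2^-1 * (x.2 ^+ 2 * ((c ^+ 2 + s ^+ 2) - c ^+ 2 + s ^+ 2) +
    x.1 ^+ 2 * ((c ^+ 2 + s ^+ 2) + c ^+ 2 - s ^+ 2)) + 2 * x.1 * x.2 * s * c)%R.
    by rewrite h; ring.
  by field.
have cF : continuous F.
  by move=> f; apply/differentiable_continuous/derivable1_diffP; case: (dF f).
rewrite (@ge0_integral_itvoo _ _ F)//.
- by congr EFin; rewrite /F sinpi sin0 /sqnorm; field.
- exact: pi_gt0.
- move=> f _.
  apply: (@continuous_comp _ _ _ (fun f => x.2 * sin f + x.1 * cos f)%R
    (fun t => t ^+ 2)%R).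
    apply: cvgD; apply: cvgM; first exact: cvg_cst.
    + exact: continuous_sin.
    + exact: cvg_cst.
    + exact: continuous_cos.
  exact: exprn_continuous.
- by move=> f _; exact: sqr_ge0.
Qed.

Lemma integral_sqr_sin : \int[leb]_(f in `]0%R, pi[) (sin f ^+ 2)%:E = (pi / 2)%:E.
Proof.
have := integral_sqr_proj (0, 1)%R; rewrite /sqnorm/= expr0n/= add0r expr1n mul1r => <-.
by apply: eq_integral => f _; rewrite mul0r addr0 mul1r.
Qed.

Let integral_nlog_sin a : (0 <= a <= pi)%R ->
  \int[leb]_(f in `]0%R, pi[) ((sin f ^+ 2)%:E * nlog (sin (f - a))) =
  (2^-1 * lnsin_const - pi / 4 * (cos a ^+ 2 - sin a ^+ 2))%:E.
Proof.
move=> api; rewrite -integral_sin_sqr_nlog_sin//.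
rewrite [RHS]integral_itv_bndoo//.
apply: emeasurable_funM => //; apply: measurable_funTS.
apply: measurableT_comp; first exact: measurable_nlog.
by apply: measurableT_comp => //; exact: measurable_funB.
Qed.

(** The angle is measured from the second axis and the sign is left free, so that [a] stays in the
    range of [acos], which is also the range of the log-sine integral; [nlog] is even, so the sign
    is harmless. *)
Let polar d : d != 0%R -> exists a r, [/\ (0 <= a <= pi)%R, (0 < r)%R &
  d = (- (r * sin a), r * cos a)%R \/ d = (r * sin a, - (r * cos a))%R].
Proof.
move=> d0.
have r20 : (0 < d.1 ^+ 2 + d.2 ^+ 2)%R.
  rewrite lt_neqAle addr_ge0 ?sqr_ge0// andbT eq_sym paddr_eq0 ?sqr_ge0//.
  rewrite !sqrf_eq0; apply: contra d0 => /andP[/eqP d1 /eqP d2].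
  by apply/eqP; case: d d1 d2 => u v /= -> ->.
pose r := Num.sqrt (d.1 ^+ 2 + d.2 ^+ 2).
have r0 : (0 < r)%R by rewrite sqrtr_gt0.
have rr : (r ^+ 2 = d.1 ^+ 2 + d.2 ^+ 2)%R by rewrite sqr_sqrtr// ltW.
have bnd (v : R) : (v ^+ 2 <= r ^+ 2)%R -> (-1 <= v / r <= 1)%R.
  move=> vr; rewrite ler_pdivlMr// ler_pdivrMr// mulN1r mul1r -ler_norml.
  by rewrite -(ler_pXn2r (_ : 0 < 2)%N) ?nnegrE ?(ltW r0)// real_normK ?num_real.
have key (u v : R) : (u <= 0)%R -> (u ^+ 2 + v ^+ 2 = r ^+ 2)%R ->
    (r * sin (acos (v / r)) = - u)%R /\ (r * cos (acos (v / r)) = v)%R.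
  move=> u0 uv.
  have vr : (-1 <= v / r <= 1)%R by apply: bnd; rewrite -uv lerDr sqr_ge0.
  split; last by rewrite acosK ?in_itv//=; field; rewrite gt_eqF.
  rewrite sin_acos//.
  have -> : (1 - (v / r) ^+ 2 = (- u / r) ^+ 2)%R.
    rewrite !expr_div_n sqrrN -(divff (lt0r_neq0 (exprn_gt0 2 r0))) -uv -mulrBl.
    by congr (_ / _)%R; ring.
  rewrite sqrtr_sqr ger0_norm ?divr_ge0 ?oppr_ge0 ?(ltW r0)//.
  by field; rewrite gt_eqF.
have acospi (v : R) : (v ^+ 2 <= r ^+ 2)%R -> (0 <= acos (v / r) <= pi)%R.
  by move=> /bnd h; rewrite acos_ge0 ?acos_lepi.
have [d10|d10] := leP d.1 0%R.
  exists (acos (d.2 / r)), r; split=> //; first by apply: acospi; rewrite rr lerDr sqr_ge0.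
  left; have [|-> ->] := key _ d.2 d10; first by rewrite rr.
  by rewrite opprK; case: (d).
exists (acos (- d.2 / r)), r; split=> //.
  by apply: acospi; rewrite sqrrN rr lerDr sqr_ge0.
right; have [||-> ->] := key (- d.1)%R (- d.2)%R; rewrite ?oppr_le0 ?(ltW d10)// ?sqrrN//.
by rewrite !opprK; case: (d).
Qed.

(** Both sides are [nlog] of [sin f * proj f d], which is [r * sin (f - a)] up to sign. *)
Let nlog_proj d a r f : (0 < r)%R -> (0 < f < pi)%R ->
  d = (- (r * sin a), r * cos a)%R \/ d = (r * sin a, - (r * cos a))%R ->
  nlog (proj f d) + nlog (sin f) = (- ln r)%:E + nlog (sin (f - a)).
Proof.
move=> r0 /sin_gt0_pi/lt0r_neq0 s0 dE; rewrite -nlogM.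
have -> : (- ln r)%:E = nlog r by rewrite /nlog gt_eqF// gtr0_norm.
rewrite -nlogM sinB; case: dE => ->; rewrite /proj/=.
  congr nlog; move: s0; move: (sin f) (cos f) (sin a) (cos a) => s c S C s0; by field.
rewrite -nlogN; congr nlog; move: s0.
by move: (sin f) (cos f) (sin a) (cos a) => s c S C s0; field.
Qed.

Let measurable_k1_proj x y : measurable_fun [set: measurableTypeR R]
  (fun f => k1 (proj f x) (proj f y)).
Proof.
have mp z : measurable_fun [set: measurableTypeR R] (fun f => proj f z : R).
  exact: (measurableT_comp measurable_proj (pair2_measurable z)).
exact: (measurableT_comp measurable_k1 (measurable_fun_pair (mp x) (mp y))).
Qed.

(** The log-sine integrals at [a] and at 0, the latter due to the rescaling by [sin f], differ by
    [pi / 4 * (1 - cos (2 a))], which is [pi / 2 * sin a ^+ 2]: the anisotropic term. The weight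
    cancels the denominator of [proj ^+ 2], and the confinement averages to the Euclidean norms. *)
Lemma integral_k1_proj x y :
  \int[leb]_(f in `]0%R, pi[) ((sin f ^+ 2)%:E * k1 (proj f x) (proj f y)) =
  (pi / 2)%:E * (W1 (x - y)%R + (2^-1 * (sqnorm x + sqnorm y))%:E).
Proof.
have pi0 : (0 < pi :> R)%R by exact: pi_gt0.
have [xy|xy] := eqVneq (x - y)%R 0%R.
  rewrite /W1 xy eqxx addye// gt0_muley ?lte_fin ?divr_gt0//.
  have -> : y = x by apply/esym/eqP; rewrite -subr_eq0 xy.
  transitivity (\int[leb]_(f in `]0%R, pi[) ((sin f ^+ 2)%:E * +oo)).
    apply: eq_integral => f _; congr (_ * _).
    by rewrite /k1 subrr /nlog eqxx addye.
  rewrite ge0_integralZr//; try exact: measurable_sqr_sin;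
    try by move=> f _; exact: sqr_sin_ge0.
  by rewrite [X in X * _]integral_sqr_sin gt0_muley// lte_fin divr_gt0.
have [a [r [api r0 dE]]] := polar xy.
have n0 : (0 <= (0 : R) <= pi)%R by rewrite lexx ltW.
(* The positive and negative parts of [ln r] go to opposite sides, so that all integrands in [key]
   are nonnegative and their integrals add up. *)
pose Lp : R := Num.max (ln r) 0%R; pose Lm : R := Num.max (- ln r)%R 0%R.
have Lp0 : (0 <= Lp)%R by rewrite le_max lexx orbT.
have Lm0 : (0 <= Lm)%R by rewrite le_max lexx orbT.
have LpLm : (Lp - Lm = ln r)%R.
  by rewrite /Lp /Lm; case: (leP (ln r) 0%R); case: (leP (- ln r)%R 0%R); lra.
pose Q f : R := (2^-1 * ((x.2 * sin f + x.1 * cos f) ^+ 2 + (y.2 * sin f + y.1 * cos f) ^+ 2))%R.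
have Q0 f : (0 <= Q f)%R by rewrite mulr_ge0// addr_ge0// sqr_ge0.
have cQ (z : R * R) : measurable_fun [set: R] (fun f => ((z.2 * sin f + z.1 * cos f) ^+ 2)%R).
  by apply: measurable_funX; apply: measurable_funD; exact: measurable_funM.
have mQ (D : set R) : measurable_fun D (EFin \o Q).
  apply/measurable_EFinP/measurable_funTS; apply: measurable_funM => //.
  by apply: measurable_funD; exact: cQ.
have IQ : \int[leb]_(f in `]0%R, pi[) (Q f)%:E =
    (2^-1 * (sqnorm x + sqnorm y) * (pi / 2))%:E.
  under eq_integral do rewrite /Q EFinM EFinD.
  rewrite ge0_integralZl//; last 2 first.
  - by apply: emeasurable_funD; apply/measurable_EFinP; exact: measurable_funTS (cQ _).
  - by move=> f _; rewrite adde_ge0// lee_fin sqr_ge0.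
  rewrite ge0_integralD//; first last.
  - by apply/measurable_EFinP; exact: measurable_funTS (cQ _).
  - by move=> f _; rewrite lee_fin sqr_ge0.
  - by apply/measurable_EFinP; exact: measurable_funTS (cQ _).
  - by move=> f _; rewrite lee_fin sqr_ge0.
  by rewrite !integral_sqr_proj -EFinD -EFinM; congr EFin; ring.
have IL (L : R) : (0 <= L)%R ->
    \int[leb]_(f in `]0%R, pi[) ((sin f ^+ 2)%:E * L%:E) = (pi / 2 * L)%:E.
  move=> L0; rewrite ge0_integralZr//; try exact: measurable_sqr_sin;
    try by move=> f _; exact: sqr_sin_ge0.
  by rewrite [X in X * _]integral_sqr_sin.
set T := \int[leb]_(f in _) _.
have mn b : measurable_fun [set: R] (fun f => (sin f ^+ 2)%:E * nlog (sin (f - b)%R)).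
  apply: emeasurable_funM => //.
  apply: measurableT_comp; first exact: measurable_nlog.
  by apply: measurableT_comp => //; exact: measurable_funB.
have n_ge0 b f : 0 <= (sin f ^+ 2)%:E * nlog (sin (f - b)%R).
  by rewrite mule_ge0// nlog_ge0// sin_max.
have mk : measurable_fun [set: measurableTypeR R]
    (fun f => (sin f ^+ 2)%:E * k1 (proj f x) (proj f y)).
  by apply: emeasurable_funM => //; exact: measurable_sqr_sin.
have k_ge0 f : 0 <= (sin f ^+ 2)%:E * k1 (proj f x) (proj f y).
  by rewrite mule_ge0// k1_ge0.
have mL (L : R) : measurable_fun [set: R] (fun f => (sin f ^+ 2)%:E * L%:E).
  exact: emeasurable_funM.
have L_ge0 (L f : R) : (0 <= L)%R -> 0 <= (sin f ^+ 2)%:E * L%:E.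
  by move=> L0; rewrite mule_ge0.
have key : T + (2^-1 * lnsin_const - pi / 4 + pi / 2 * Lp)%:E =
  (2^-1 * lnsin_const - pi / 4 * (cos a ^+ 2 - sin a ^+ 2) +
   2^-1 * (sqnorm x + sqnorm y) * (pi / 2) + pi / 2 * Lm)%:E.
  transitivity (T + \int[leb]_(f in `]0%R, pi[) ((sin f ^+ 2)%:E * nlog (sin (f - 0)))
      + \int[leb]_(f in `]0%R, pi[) ((sin f ^+ 2)%:E * Lp%:E)).
    rewrite integral_nlog_sin// IL// cos0 sin0 expr1n expr0n/= subr0 mulr1.
    by rewrite (EFinD (2^-1 * lnsin_const - pi / 4)%R) addeA.
  transitivity (\int[leb]_(f in `]0%R, pi[) ((sin f ^+ 2)%:E * nlog (sin (f - a))) +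
      \int[leb]_(f in `]0%R, pi[) (Q f)%:E +
      \int[leb]_(f in `]0%R, pi[) ((sin f ^+ 2)%:E * Lm%:E)); last first.
    by rewrite integral_nlog_sin// IL// IQ -!EFinD.
  have mT g : measurable_fun [set: R] g -> measurable_fun `]0%R, pi[ (g : R -> \bar R).
    exact: measurable_funTS.
  rewrite /T -!ge0_integralD//; try (by apply: mT); try (by move=> f _; exact: L_ge0);
    try (by apply: emeasurable_funD => //; exact: mT);
    try (by move=> f _; rewrite adde_ge0// lee_fin);
    try (by move=> f _; rewrite lee_fin).
  apply: eq_integral => f; rewrite inE/= in_itv/= => fpi.
  have s0 := sin_gt0_pi fpi.
  have -> : (Q f)%:E = (sin f ^+ 2)%:E * (2^-1 * (proj f x ^+ 2 + proj f y ^+ 2))%:E.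
    rewrite -EFinM; congr EFin; rewrite /Q /proj.
    by move: (sin f) (cos f) s0 => s c /lt0r_neq0 s0; field.
  set q : R := (2^-1 * (proj f x ^+ 2 + proj f y ^+ 2))%R.
  have q0 : (0 <= q)%R by rewrite mulr_ge0// addr_ge0// sqr_ge0.
  have n0' b : 0 <= nlog (sin (f - b)%R) by rewrite nlog_ge0// sin_max.
  have k0 := k1_ge0 (proj f x) (proj f y).
  have D3 (u v w : \bar R) : 0 <= u -> 0 <= v -> 0 <= w ->
      (sin f ^+ 2)%:E * u + (sin f ^+ 2)%:E * v + (sin f ^+ 2)%:E * w =
      (sin f ^+ 2)%:E * (u + v + w).
    by move=> u0 v0 w0; rewrite ge0_muleDr ?adde_ge0// ge0_muleDr.
  rewrite !D3 ?lee_fin//; congr (_ * _)%E.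
  have projB : (proj f x - proj f y = proj f (x - y))%R by rewrite /proj/=; ring.
  rewrite subr0 /k1 -/q projB [X in X + _]addeAC.
  rewrite (nlog_proj r0 fpi dE).
  by rewrite [(- ln r)%:E + _]addeC -!addeA; congr (_ + _);
    rewrite -!EFinD; congr EFin; rewrite -LpLm; ring.
have -> : T = (2^-1 * lnsin_const - pi / 4 * (cos a ^+ 2 - sin a ^+ 2) +
   2^-1 * (sqnorm x + sqnorm y) * (pi / 2) + pi / 2 * Lm -
   (2^-1 * lnsin_const - pi / 4 + pi / 2 * Lp))%:E.
  rewrite EFinB -key addeK//.
rewrite /W1 (negbTE xy) -EFinD -EFinM; congr EFin.
have d1 : ((x - y).1 ^+ 2 = r ^+ 2 * sin a ^+ 2)%R by case: dE => -> /=; ring.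
have d2 : ((x - y).2 ^+ 2 = r ^+ 2 * cos a ^+ 2)%R by case: dE => -> /=; ring.
rewrite d1 d2 -mulrDr [(sin a ^+ 2 + _)%R]addrC cos2Dsin2 mulr1 lnXn//.
rewrite cos2sin2 -LpLm.
have r2 : (r ^+ 2 * sin a ^+ 2 / r ^+ 2 = sin a ^+ 2)%R by field; rewrite gt_eqF.
by rewrite r2; field.
Qed.

End projections.

(** * Energies of the projected laws, minimality and uniqueness *)

Section projected_laws.
Context {R : realType}.
Local Notation leb := (@lebesgue_measure R).
Local Notation sc := (@semicircle R).
Local Notation C0 := (@potential_min R).
Implicit Types (nu : probability (R * R)%type R) (f : R).
Local Open Scope ereal_scope.

HB.instance Definition _ f :=
  @isMeasurableFun.Build _ _ _ _ (proj f) (measurable_proj1 f).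

Definition proj_law nu f : probability R R := distribution nu (proj f).

Let energy nu f := interaction (proj_law nu f) (proj_law nu f).

Definition weight f : R := (\1_(`]0%R, pi[%classic : set R) f * sin f ^+ 2)%R.

Lemma weight_ge0 f : (0 <= weight f)%R.
Proof. by rewrite mulr_ge0 ?sqr_ge0. Qed.

Lemma weight_gt0 f : (0 < f < pi)%R -> (0 < weight f)%R.
Proof.
move=> fpi; rewrite /weight indicE mem_set ?mul1r ?exprn_gt0 ?sin_gt0_pi//.
Qed.

Let measurable_weight : measurable_fun [set: measurableTypeR R] weight.
Proof.
apply: measurable_funM; first by apply: measurable_indic; exact: measurable_itv.
by apply: measurable_funX; apply: continuous_measurable_fun; exact: continuous_sin.
Qed.

Let integral_weight (g : R -> \bar R) :
  \int[leb]_(f in `]0%R, pi[) ((sin f ^+ 2)%:E * g f) = \int[leb]_f ((weight f)%:E * g f).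
Proof.
rewrite integral_mkcond; apply: eq_integral => f _.
rewrite /patch /weight indicE; case: ifPn => _; first by rewrite mul1r.
by rewrite mul0r mul0e.
Qed.

Lemma integral_weight_cst : \int[leb]_f (weight f)%:E = (pi / 2)%:E.
Proof.
rewrite -integral_sqr_sin.
have := integral_weight (cst 1); under eq_integral do rewrite mule1.
by move=> ->; apply: eq_integral => f _; rewrite mule1.
Qed.

Let measurable_k1_proj2 f : measurable_fun [set: (R * R) * (R * R)]
  (fun z => k1 (proj f z.1) (proj f z.2)).
Proof.
have p1 := measurableT_comp (measurable_proj1 f) measurable_fst.
have p2 := measurableT_comp (measurable_proj1 f) measurable_snd.
exact: (measurableT_comp measurable_k1 (measurable_fun_pair (p1 _ _) (p2 _ _))).
Qed.

Lemma interaction_proj_law nu f :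
  energy nu f = \int[nu \x nu]_z k1 (proj f z.1) (proj f z.2).
Proof.
rewrite /energy /interaction fubini_tonelli1; first last.
- by move=> z; exact: k1_ge0.
- exact: measurable_k1.
rewrite fubini_tonelli1//; last by move=> z; exact: k1_ge0.
rewrite /fubini_F/= ge0_integral_pushforward//=; first last.
- by move=> p _; apply: integral_ge0 => q _; exact: k1_ge0.
- apply: (@measurable_fun_fubini_tonelli_F _ _ _ _ R (proj_law nu f) (fun z => k1 z.1 z.2)).
    exact: measurable_k1.
  by move=> z; exact: k1_ge0.
rewrite preimage_setT; apply: eq_integral => x _ /=.
rewrite ge0_integral_pushforward//=; first last.
- by move=> p _; exact: k1_ge0.
- exact: measurable_k1l.
Qed.

Let F (w : ((R * R) * (R * R)) * measurableTypeR R) : \bar R :=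
  (weight w.2)%:E * k1 (proj w.2 w.1.1) (proj w.2 w.1.2).

Let mF : measurable_fun setT F.
Proof.
apply: emeasurable_funM.
  by apply/measurable_EFinP; exact: measurableT_comp.
have p1 : measurable_fun [set: (R * R) * (R * R) * measurableTypeR R]
    (fun w => proj w.2 w.1.1).
  apply: (measurableT_comp measurable_proj (measurable_fun_pair measurable_snd _)).
  exact: (measurableT_comp measurable_fst measurable_fst).
have p2 : measurable_fun [set: (R * R) * (R * R) * measurableTypeR R]
    (fun w => proj w.2 w.1.2).
  apply: (measurableT_comp measurable_proj (measurable_fun_pair measurable_snd _)).
  exact: (measurableT_comp measurable_snd measurable_fst).
exact: (measurableT_comp measurable_k1 (measurable_fun_pair p1 p2)).
Qed.

Let F_ge0 w : 0 <= F w.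
Proof. by rewrite mule_ge0 ?k1_ge0// lee_fin weight_ge0. Qed.

Let weight_energyE nu f :
  (weight f)%:E * energy nu f = \int[nu \x nu]_z F (z, f).
Proof.
rewrite interaction_proj_law -ge0_integralZl//.
- by move=> z _; exact: k1_ge0.
- by rewrite lee_fin weight_ge0.
Qed.

Let measurable_weight_energy nu :
  measurable_fun [set: measurableTypeR R] (fun f => (weight f)%:E * energy nu f).
Proof.
under eq_fun do rewrite weight_energyE.
pose nu2 : probability _ R := (nu \x nu)%E.
exact: (@measurable_fun_fubini_tonelli_G _ _ _ _ R nu2 F).
Qed.

Lemma I1_proj_law nu : I1 nu = (pi^-1)%:E * \int[leb]_f ((weight f)%:E * energy nu f).
Proof.
have pi0 : (0 < pi :> R)%R by exact: pi_gt0.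
have -> : \int[leb]_f ((weight f)%:E * energy nu f) =
    \int[nu \x nu]_z \int[leb]_f F (z, f).
  pose nu2 : probability _ R := (nu \x nu)%E.
  apply: etrans (esym (@fubini_tonelli _ _ _ _ R nu2 leb F mF F_ge0)).
  by apply: eq_integral => f _; exact: weight_energyE.
have FW z : (2 / pi)%:E * \int[leb]_f F (z, f) =
    W1 (z.1 - z.2)%R + (2^-1 * (sqnorm z.1 + sqnorm z.2))%:E.
  rewrite /F/= -integral_weight integral_k1_proj muleA -EFinM.
  by rewrite mulrA mulfVK ?gt_eqF// divff// mul1e.
rewrite /I1; under eq_integral do rewrite -FW.
rewrite ge0_integralZl//.
- rewrite muleA -EFinM; by rewrite mulrA mulVf// mul1r.
- exact: (@measurable_fun_fubini_tonelli_F _ _ _ _ R leb F).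
- by move=> z _; exact: integral_ge0.
- by rewrite lee_fin divr_ge0// ltW.
Qed.


Lemma eq_interaction (rho tau : probability R R) :
  (forall A : set R, measurable A -> rho A = tau A) ->
  interaction rho rho = interaction tau tau.
Proof.
move=> h; rewrite /interaction !fubini_tonelli1; try exact: measurable_k1;
  try by move=> z; exact: k1_ge0.
rewrite /fubini_F/=.
transitivity (\int[tau]_p \int[rho]_q k1 p q).
  by apply: eq_measure_integral => A mA _; exact: h.
apply: eq_integral => p _.
by apply: eq_measure_integral => A mA _; exact: h.
Qed.

Let axis : set (R * R) := [set x | x.1 = 0%R].

Let measurable_axis : measurable axis.
Proof.
have -> : axis = [set 0%R] `*` setT by apply/seteqP; split => -[x1 x2] //= [].
by apply: measurableX => //; exact: measurable_set1.
Qed.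

Let eq_on_axis nu (A B : set (R * R)) : nu (~` axis) = 0 ->
  measurable A -> measurable B -> A `&` axis = B `&` axis -> nu A = nu B.
Proof.
move=> nu0 mA mB AB.
have h (C : set (R * R)) : measurable C -> nu C = nu (C `&` axis).
  move=> mC; rewrite (measureDI nu mC measurable_axis).
  rewrite -[RHS]add0e; congr (_ + _).
  apply: (subset_measure0 _ _ _ nu0).
  - exact: measurableD.
  - exact: measurableC.
  - by move=> x [].
by rewrite (h A)// AB -h.
Qed.

(** On the axis [x.1 = 0] every rescaled projection is the second coordinate, so the projected law
    is the second marginal in every direction. This serves for [mu1] and, once concentrated on the
    axis, for any other minimiser. *)
Let proj_law_on_axis nu f (A : set R) : nu (~` axis) = 0 -> measurable A ->
  proj_law nu f A = nu (setT `*` A).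
Proof.
move=> nu0 mA; apply: eq_on_axis => //.
- by rewrite -[X in measurable X]setTI; exact: measurable_proj1.
- exact: measurableX.
- have pe (x1 x2 : R) : x1 = 0%R -> proj f (x1, x2) = x2.
    by move=> e; rewrite /proj/= e mul0r addr0.
  apply/seteqP; split => -[x1 x2] /= [h x10]; split=> //.
    by rewrite -(pe x1 x2 x10).
  by rewrite (pe x1 x2 x10); case: h.
Qed.

Lemma proj_law_mu1 f (A : set R) : measurable A -> proj_law mu1 f A = sc A.
Proof.
have mX (B C : set R) : measurable B -> measurable C ->
    @mu1 R (B `*` C) = \d_(0%R : R) B * sc C.
  by move=> mB mC; exact: (product_measure1E (\d_(0%R : R))%R sc mB mC).
move=> mA; rewrite proj_law_on_axis//.
  by apply: (etrans (mX _ _ measurableT mA)); rewrite diracT mul1e.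
have -> : ~` axis = (~` [set 0%R]) `*` setT.
  by apply/seteqP; split => -[x1 x2] //= [].
apply: etrans (mX _ _ _ _) _ => //; first by apply: measurableC; exact: measurable_set1.
by rewrite diracE memNset ?mul0e//= => /(_ erefl).
Qed.

Let C0_ge0 : (0 <= C0)%R.
Proof. by rewrite -lee_fin -interaction_sc_sc interaction_ge0. Qed.

Let integral_weight_C0 : \int[leb]_f ((weight f)%:E * C0%:E) = (pi / 2 * C0)%:E.
Proof.
rewrite ge0_integralZr//; last 2 first.
- exact/measurable_EFinP.
- by move=> f _; rewrite lee_fin weight_ge0.
by rewrite [X in X * _]integral_weight_cst.
Qed.

Lemma I1_mu1 : I1 mu1 = (pi^-1)%:E * (pi / 2 * C0)%:E.
Proof.
rewrite I1_proj_law -integral_weight_C0; congr (_ * _); apply: eq_integral => f _.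
by rewrite /energy (eq_interaction (@proj_law_mu1 f)) interaction_sc_sc.
Qed.

Let box_dist_ge0 m rho tau : 0 <= @box_dist R m rho tau.
Proof. by apply: integral_ge0 => w _; rewrite lee_fin sqr_ge0. Qed.

Let energy_ge nu f : C0%:E <= energy nu f.
Proof.
by apply: le_trans (semicircle_energy_le 0 (proj_law nu f)); rewrite leeDl.
Qed.

Let weight_energy_ge nu f : (weight f)%:E * C0%:E <= (weight f)%:E * energy nu f.
Proof. by apply: lee_pmul => //; rewrite lee_fin weight_ge0. Qed.

Lemma mu1_minimiser : is_minimiser (@I1 R) (@mu1 R).
Proof.
move=> nu; rewrite I1_mu1 I1_proj_law lee_pmul2l ?lte_fin ?invr_gt0 ?pi_gt0//.
rewrite -integral_weight_C0; apply: ge0_le_integral => //.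
- by move=> f _; rewrite mule_ge0// lee_fin ?weight_ge0.
- by apply: emeasurable_funM => //; exact/measurable_EFinP.
Qed.

(** The projected energies are at least [C0] and their weighted integral does not exceed that of
    [C0], so equality holds in almost every direction; there the excess energy, hence every
    [box_dist] to [sc], is 0. *)
Lemma minimiser_proj_law nu : I1 nu <= I1 mu1 ->
  {ae leb, forall f, (0 < f < pi)%R ->
    forall A : set R, measurable A -> proj_law nu f A = sc A}.
Proof.
rewrite I1_mu1 I1_proj_law lee_pmul2l ?lte_fin ?invr_gt0 ?pi_gt0// => le_nu.
pose w f : \bar R := (weight f)%:E * C0%:E.
pose e f : \bar R := (weight f)%:E * energy nu f.
have mw : measurable_fun [set: measurableTypeR R] w.
  by apply: emeasurable_funM => //; exact/measurable_EFinP.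
have me : measurable_fun [set: measurableTypeR R] e by exact: measurable_weight_energy.
have w_fin f : w f \is a fin_num by rewrite /w -EFinM.
have ew0 f : 0 <= e f - w f by rewrite sube_ge0 ?w_fin//; exact: weight_energy_ge.
have mew : measurable_fun [set: measurableTypeR R] (fun f => e f - w f).
  exact: emeasurable_funB.
have Iew : \int[leb]_f (e f - w f) = 0.
  apply/eqP; rewrite eq_le integral_ge0 ?andbT//.
  have : \int[leb]_f w f + \int[leb]_f (e f - w f) <= (pi / 2 * C0)%:E + 0.
    rewrite -ge0_integralD//; last first.
      by move=> f _; rewrite mule_ge0// lee_fin weight_ge0.
    by rewrite adde0; under eq_integral do rewrite addeC subeK//.
  by rewrite integral_weight_C0 leeD2lE.
have : {ae leb, forall f, setT f -> e f - w f = 0}.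
  apply/(ae_eq_integral_abs leb measurableT mew).
  by rewrite -Iew; apply: eq_integral => f _; rewrite gee0_abs.
apply: negligibleS => f /=; apply: contra_not => /(_ I) h fpi.
have ef : energy nu f = C0%:E.
  have : e f = w f by rewrite -[LHS](subeK _ (w_fin f)) h add0e.
  move=> /(congr1 (fun t => ((weight f)^-1)%:E * t)).
  rewrite /e /w !muleA -!(EFinM (weight f)^-1%R) mulVf ?mul1e//.
  by rewrite gt_eqF// weight_gt0.
apply: box_dist_separates => m; apply/eqP; rewrite eq_le box_dist_ge0 andbT.
have := semicircle_energy_le m (proj_law nu f).
by rewrite -[interaction _ _]/(energy nu f) ef -[leRHS]adde0 leeD2lE.
Qed.

Let s2 : R := Num.sqrt 2.

Let cot_ge k f : (0 < f < atan k.+1%:R^-1)%R -> (k.+1%:R <= cos f / sin f)%R.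
Proof.
move=> /andP[f0 fk].
have f2 : (f < pi / 2)%R by exact: lt_trans fk (atan_ltpi2 _).
have pi2 : (0 < pi / 2 :> R)%R by rewrite divr_gt0 ?pi_gt0.
have fpi2 : (- (pi / 2) < f < pi / 2)%R by rewrite f2 (lt_trans _ f0)// oppr_lt0.
have lt_tan : (tan f < k.+1%:R^-1)%R.
  by rewrite -[ltRHS]atanK ltr_tan ?in_itv//= atan_gtNpi2 atan_ltpi2.
have tan0 : (0 < tan f)%R.
  by rewrite /tan divr_gt0// ?sin_gt0_pihalf ?cos_gt0_pihalf ?f0.
by rewrite -invf_div -[leLHS]invrK lef_pV2 ?posrE// ltW.
Qed.

(** For each [k], almost every point satisfies [|x2 + x1 * cot (fs k)| < s2] with a cotangent of at
    least [k + 1]. All these bounds hold together off a countable union of null sets, and they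
    exclude [x1 != 0]. *)
Let axis_null nu (fs : R^nat) :
  (forall k, (0 < fs k < atan k.+1%:R^-1)%R) ->
  (forall k (A : set R), measurable A -> proj_law nu (fs k) A = sc A) ->
  nu (~` axis) = 0.
Proof.
move=> fsP lawE.
pose S : set R := `](- s2)%R, s2[%classic.
have mS : measurable (~` S) by apply: measurableC; exact: measurable_itv.
pose N k := proj (fs k) @^-1` (~` S).
have mN k : measurable (N k).
  by rewrite /N -[X in measurable X]setTI; exact: measurable_proj1.
have N0 k : nu (N k) = 0.
  transitivity (proj_law nu (fs k) (~` S)); first by [].
  by rewrite lawE// /semicircle setICl integral_set0.
have : nu.-negligible (~` axis).
  have : nu.-negligible (\bigcup_k N k).
    by apply: negligible_bigcup => k; exists (N k); split; [exact: mN|exact: N0|].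
  apply: negligibleS.
  move=> -[x1 x2] /= /eqP x10; apply: contrapT => xN.
  have {}xN k : (`|x2 + x1 * (cos (fs k) / sin (fs k))| < s2)%R.
    have /contrapT : ~ N k (x1, x2) by move=> xNk; apply: xN; exists k.
    by rewrite /S/= in_itv/= -ltr_norml.
  have x1p : (0 < `|x1|)%R by rewrite normr_gt0.
  (* Chosen so that [(k + 1) * |x1|] exceeds [s2 + |x2|]. *)
  pose k := Num.truncn ((s2 + `|x2|) / `|x1|).
  have := xN k; apply/negP; rewrite -leNgt.
  have h : (s2 + `|x2| <= `|x1 * (cos (fs k) / sin (fs k))|)%R.
    rewrite normrM mulrC -ler_pdivrMr//; apply: (@le_trans _ _ k.+1%:R%R).
      by rewrite ltW// Num.Theory.truncnS_gt.
    by rewrite (le_trans (cot_ge (fsP k)))// ler_norm.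
  rewrite addrC -[X in (_ + X)%R]opprK; apply: le_trans (lerB_dist _ _).
  by rewrite normrN lerBrDr.
by move=> /negligibleP; apply; apply: measurableC.
Qed.

Lemma minimiser_eq_mu1 nu (A : set (R * R)) : I1 nu <= I1 mu1 -> measurable A -> nu A = mu1 A.
Proof.
move=> /minimiser_proj_law law_ae mA.
have : forall k : nat, exists f, (0 < f < atan k.+1%:R^-1)%R /\
    forall B : set R, measurable B -> proj_law nu f B = sc B.
  move=> k; have [|f fk fP] := ae_itvoo _ law_ae (a := 0%R) (b := atan k.+1%:R^-1).
    by rewrite -(@atan0 R) lt_atan ?invr_gt0.
  exists f; split => //; apply: fP; case/andP : fk => -> /= /lt_trans; apply.
  by rewrite (lt_trans (atan_ltpi2 _))// gtr_pMr ?pi_gt0// invf_lt1 ?ltr1n.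
move=> /choice[fs fsP].
have nu0 : nu (~` axis) = 0.
  by apply: (@axis_null nu fs) => k; [case: (fsP k)|case: (fsP k)].
apply/esym; apply: (@product_measure_unique _ _ _ _ R (\d_(0%R : R))%R sc nu) => //.
(* Rectangles suffice: with 0 in [B] the rectangle meets the axis as the full strip over [C] does,
   and its mass is that of [C] under one projection; otherwise it misses the axis and is null. *)
move=> B C mB mC; have [B0|B0] := pselect (B 0%R).
  rewrite [X in X * _]diracE mem_set// mul1e.
  apply: etrans ((fsP 0%N).2 C mC); rewrite proj_law_on_axis//.
  apply: eq_on_axis => //; try exact: measurableX.
  by apply/seteqP; split => -[x1 x2] /= [[h1 h2] x10]; do 2!split => //;
    rewrite (_ : x1 = 0%R).
rewrite [X in X * _]diracE memNset// mul0e.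
apply: (subset_measure0 _ _ _ nu0).
- exact: measurableX.
- exact: measurableC.
- by move=> [x1 x2] /= [Bx1 _] x10; apply: B0; rewrite -x10.
Qed.

End projected_laws.

Theorem corollary3p3 (R : realType) :
  is_minimiser (@I1 R) (@mu1 R) /\
  forall mu : probability (R * R)%type R, is_minimiser (@I1 R) mu ->
    forall A : set (R * R), measurable A -> mu A = mu1 A.
Proof.
split; first exact: mu1_minimiser.
by move=> mu mu_min A; apply: minimiser_eq_mu1; exact: mu_min.
Qed.
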